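(* Let $n\ge2$ and let $X=(X_1,\dots,X_n)$ be a random vector in $\mathbb{R}^n$ whose components $X_k$ are independent, identically distributed, have mean zero and finite second moment. Then $$ \mathbb{E}_\theta\, \rho(F_\theta,G) \, \leq \, c\,\sqrt{\frac{\log n}{n}}, $$ where the constant $c$ depends on the distribution of $X_1$ only (in particular, not on $n$).
   Context: $|\cdot|$ and $\langle\cdot,\cdot\rangle$ are the Euclidean norm and inner product on $\mathbb{R}^n$. $S^{n-1}=\{\theta\in\mathbb{R}^n: |\theta|=1\}$, $\mu_{n-1}$ is the uniform (rotation-invariant) probability measure on $S^{n-1}$, and $\mathbb{E}_\theta$ denotes integration over $\theta\in S^{n-1}$ with respect to $\mu_{n-1}$. For $\theta\in S^{n-1}$, $F_\theta(x)=\mathbb{P}\{\langle X,\theta\rangle\le x\}$, $x\in\mathbb{R}$. $G$ is the distribution function of the random variable $rZ$, where $r=\frac{1}{\sqrt n}|X|$ and $Z\sim N(0,1)$ is independent of $r$. For distribution functions $U,V$ on $\mathbb{R}$, $\rho(U,V)=\sup_{x\in\mathbb{R}}|U(x)-V(x)|$. *)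

(* Defs.v *)
From HB Require Import structures.
From mathcomp Require Import all_boot all_order all_algebra.
From mathcomp Require Import all_classical all_reals all_analysis.

Set Implicit Arguments.
Unset Strict Implicit.
Unset Printing Implicit Defensive.

Import Order.TTheory GRing.Theory Num.Theory.
Import numFieldNormedType.Exports.

Local Open Scope classical_set_scope.
Local Open Scope ring_scope.

(* R^n is n.-tuple R, whose canonical sigma-algebra (generated by the *)
(* coordinates) is the Borel one. *)
Definition dot (R : realType) (n : nat) (x y : n.-tuple R) : R :=
  \sum_(i < n) tnth x i * tnth y i.

(* The library norm on row vectors is the sup norm, hence this one. *)
Definition enorm (R : realType) (n : nat) (x : n.-tuple R) : R :=
  Num.sqrt (dot x x).

Definition sphere (R : realType) (n : nat) : set (n.-tuple R) :=
  [set x | enorm x = 1].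
Arguments sphere : clear implicits.

Definition apply_mx (R : realType) (n : nat) (Q : 'M[R]_n) (x : n.-tuple R) :
    n.-tuple R :=
  [tuple \sum_(j < n) Q i j * tnth x j | i < n].

(* Characterizes a unique measure: the uniform probability measure on the *)
(* sphere, viewed as a measure on R^n. *)
Definition uniform_on_sphere (R : realType) (n : nat)
    (sigma : probability (n.-tuple R) R) : Prop :=
  sigma (sphere R n) = 1%E /\
  forall (Q : 'M[R]_n) (A : set (n.-tuple R)),
    Q *m Q^T = 1%:M -> measurable A -> sigma (apply_mx Q @^-1` A) = sigma A.

Definition mutually_independent (R : realType) (d : measure_display)
    (T : measurableType d) (P : probability T R) (n : nat)
    (Y : 'I_n -> T -> R) : Prop :=
  forall (J : {set 'I_n}) (A : 'I_n -> set R),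
    (forall i, measurable (A i)) ->
    P (\bigcap_(i in [set` J]) (Y i @^-1` A i)) =
    (\prod_(i in J) P (Y i @^-1` A i))%E.

Definition component (R : realType) (d : measure_display)
    (T : measurableType d) (n : nat) (X : T -> n.-tuple R) (k : 'I_n) :
    T -> R :=
  fun w => tnth (X w) k.

Definition iid_components (R : realType) (d : measure_display)
    (T : measurableType d) (P : probability T R) (n : nat)
    (X : T -> n.-tuple R) (mu : probability R R) : Prop :=
  mutually_independent P (component X) /\
  forall (k : 'I_n) (A : set R),
    measurable A -> P (component X k @^-1` A) = mu A.

Definition Ftheta (R : realType) (d : measure_display)
    (T : measurableType d) (P : probability T R) (n : nat)
    (X : T -> n.-tuple R) (theta : n.-tuple R) (x : R) : R :=
  fine (P [set w | dot (X w) theta <= x]).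

Definition radius (R : realType) (d : measure_display)
    (T : measurableType d) (n : nat) (X : T -> n.-tuple R) (w : T) : R :=
  enorm (X w) / Num.sqrt n%:R.

(* The pair (r, Z) with Z standard normal and independent of r is realized on *)
(* the product of the sample space with (R, N(0,1)). *)
Definition Gdf (R : realType) (d : measure_display)
    (T : measurableType d) (P : probability T R) (n : nat)
    (X : T -> n.-tuple R) (x : R) : R :=
  fine ((P \x normal_prob (0 : R) 1)%E
    [set wz : T * measurableTypeR R | radius X wz.1 * wz.2 <= x]).

Definition rho (R : realType) (U V : R -> R) : \bar R :=
  ereal_sup [set `|U x - V x|%:E | x in [set: R]].

(* Main.v *)
Require Import Defs.
From HB Require Import structures.
From mathcomp Require Import all_boot all_order all_algebra.
From mathcomp Require Import all_classical all_reals all_analysis.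
From mathcomp Require Import measurable_realfun.
From mathcomp Require Import zify ring lra.

Set Implicit Arguments.
Unset Strict Implicit.
Unset Printing Implicit Defensive.

Import Order.TTheory GRing.Theory Num.Theory.
Import numFieldNormedType.Exports.

Local Open Scope classical_set_scope.
Local Open Scope ring_scope.

(* Let [l = |Z| / sqrt n] with [Z] a standard Gaussian vector independent of
   [theta].  Since [G] is a mixture of centred normal laws, replacing [x] by
   [l x] changes [G x] by at most [2 |l - 1|], whose mean is [O(1 / sqrt n)];
   so [theta] may be replaced by [l theta].  By rotation invariance
   [E cos (t l <u, theta>) = exp (- t^2 |u|^2 / (2 n))] exactly, hence the mean
   square over [theta] and [Z] of the difference between the characteristic
   functions of [<X, l theta>] and of [r Z] is [a(s)^n - b(s)^(2 n)] with
   [s = t^2 / (2 n)], [a(s) = E exp (- s (X_1 - X_2)^2)] and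
   [b(s) = E exp (- s X_1^2)].  A second moment and mean zero give
   [a(s) - b(s)^2 = O(s^2)], and [a(s) <= exp (- c min(s, 1))] with [c > 0]
   unless [X_1 = 0].  Inserting this in an Esseen-type inequality with Gaussian
   smoothing at scale [1 / sqrt n], where the frequency [t = sqrt n w] is itself
   integrated against the standard normal law of [w], even yields
   [O(1 / sqrt n)]. *)

(** * Integrals of bounded measurable functions *)

(** On the sphere itself [E cos (t <u, theta>)] is a Bessel-type function of [|u|], which does not
    factor over the coordinates of [u]. The factor [l] turns it into an exponential of [|u|^2],
    whose mean over independent coordinates is an [n]-th power. Mean squares are used because the
    squared modulus of a characteristic function is an average over two independent copies of [X],
    to which the same formula applies with [u] their difference. The price of [l] is paid by [G]
    alone: [F_theta (x)] is exactly the distribution function for [l theta] at [l x]. With two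
    moments only, [a(s) - b(s)^2 = O(s^2)] has to come from expansions in which no power of [X_1]
    above the second appears. The resulting deviation is of order [sqrt n w^2] at frequency
    [sqrt n w], which compensates the singularity [1 / |w|] of the smoothing inequality. Undoing the
    smoothing requires increments of [G] of order [1 / sqrt n] over steps of that length, although
    [G] may have an atom at [0]. This holds because [|X|^2 < q n] has exponentially small
    probability for small [q], as [b(1) < 1]. *)

Section RealIntegrable.
Context {R : realType} {d} {T : measurableType d} (mu : {measure set T -> \bar R}).
Implicit Types f g : T -> R.

Lemma intRD f g : mu.-integrable setT (EFin \o f) -> mu.-integrable setT (EFin \o g) ->
  mu.-integrable setT (EFin \o (fun x => f x + g x)).
Proof. by move=> i j; exact: (integrableD measurableT i j). Qed.

Lemma intRB f g : mu.-integrable setT (EFin \o f) -> mu.-integrable setT (EFin \o g) ->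
  mu.-integrable setT (EFin \o (fun x => f x - g x)).
Proof. by move=> i j; exact: (integrableB measurableT i j). Qed.

Lemma intRZl f (r : R) : mu.-integrable setT (EFin \o f) ->
  mu.-integrable setT (EFin \o (fun x => r * f x)).
Proof. by move=> i; exact: (integrableZl measurableT r i). Qed.

Lemma le_intR f g : measurable_fun setT f -> (forall x, `|f x| <= g x) ->
  mu.-integrable setT (EFin \o g) -> mu.-integrable setT (EFin \o f).
Proof.
move=> mf fg; apply: le_integrable => //; first exact/measurable_EFinP.
by move=> x _; rewrite lee_fin/= (le_trans (fg x))// ler_norm.
Qed.

End RealIntegrable.

Section BoundedMeasurable.
Context {R : realType}.

(** Stable under the operations used below, integrable for every probability and sufficient for
    Fubini: most integrability side conditions reduce to this predicate. *)
Definition bmeas {d} {T : measurableType d} (f : T -> R) : Prop :=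
  measurable_fun setT f /\ exists M : R, forall x, `|f x| <= M.

Context {d} {T : measurableType d}.
Implicit Types (P : probability T R) (f g : T -> R).

Lemma bmeas_integrable P f : bmeas f -> P.-integrable setT (EFin \o f).
Proof.
move=> [mf [M fM]]; apply: measurable_bounded_integrable => //.
  by rewrite (le_lt_trans (probability_le1 _ _))// ltry.
by exists M; split; [exact: num_real|move=> x Mx y _; exact: le_trans (fM y) (ltW Mx)].
Qed.

Lemma EFin_Rintegral P f : P.-integrable setT (EFin \o f) ->
  (\int[P]_x (f x)%:E)%E = (\int[P]_x f x)%:E.
Proof. by move=> fi; rewrite fineK//; exact: integrable_fin_num. Qed.

Lemma Rintegral_cstT P (r : R) : \int[P]_x r = r.
Proof. by rewrite Rintegral_cst//= probability_setT mulr1. Qed.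

Lemma bmeas_cst (r : R) : bmeas (fun _ : T => r).
Proof. by split => //; exists `|r|. Qed.

Lemma bmeasD f g : bmeas f -> bmeas g -> bmeas (fun x => f x + g x).
Proof.
move=> [mf [M fM]] [mg [K gK]]; split; first exact: measurable_funD.
by exists (M + K) => x; rewrite (le_trans (ler_normD _ _))// lerD.
Qed.

Lemma bmeasM f g : bmeas f -> bmeas g -> bmeas (fun x => f x * g x).
Proof.
move=> [mf [M fM]] [mg [K gK]]; split; first exact: measurable_funM.
by exists (M * K) => x; rewrite normrM ler_pM.
Qed.

Lemma bmeasN f : bmeas f -> bmeas (fun x => - f x).
Proof.
move=> [mf [M fM]]; split; first exact: measurableT_comp.
by exists M => x; rewrite normrN.
Qed.

Lemma bmeasB f g : bmeas f -> bmeas g -> bmeas (fun x => f x - g x).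
Proof. by move=> bf bg; apply: bmeasD => //; exact: bmeasN. Qed.

Lemma bmeas_norm f : bmeas f -> bmeas (fun x => `|f x|).
Proof.
move=> [mf [M fM]]; split; first exact: measurableT_comp.
by exists M => x; rewrite normr_id.
Qed.

Lemma bmeas_comp {d'} {T' : measurableType d'} (h : T' -> T) f :
  measurable_fun setT h -> bmeas f -> bmeas (fun x => f (h x)).
Proof.
move=> mh [mf [M fM]]; split; first exact: measurableT_comp.
by exists M => x.
Qed.

Lemma bmeas_cos f : measurable_fun setT f -> bmeas (fun x => cos (f x)).
Proof.
move=> mf; split; last by exists 1 => x; rewrite ler_norml cos_geN1 cos_le1.
by apply: measurableT_comp => //; apply: continuous_measurable_fun; exact: continuous_cos.
Qed.

Lemma bmeas_sin f : measurable_fun setT f -> bmeas (fun x => sin (f x)).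
Proof.
move=> mf; split; last by exists 1 => x; rewrite ler_norml sin_geN1 sin_le1.
by apply: measurableT_comp => //; apply: continuous_measurable_fun; exact: continuous_sin.
Qed.

Lemma bmeas_expN f : measurable_fun setT f -> (forall x, 0 <= f x) ->
  bmeas (fun x => expR (- f x)).
Proof.
move=> mf f0; split.
  by apply: measurableT_comp => //; exact: measurableT_comp.
by exists 1 => x; rewrite ger0_norm ?expR_ge0// -expR0 ler_expR oppr_le0.
Qed.

Lemma bmeas_Rintegral_norm P f (M : R) : measurable_fun setT f ->
  (forall x, `|f x| <= M) -> `|\int[P]_x f x| <= M.
Proof.
move=> mf fM; have fi : bmeas f by split => //; exists M.
apply: le_trans (le_normr_Rintegral _ _) _ => //; first exact: bmeas_integrable.
rewrite -[leRHS](Rintegral_cstT P); apply: le_Rintegral => //.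
  by apply: bmeas_integrable; exact: bmeas_norm.
by apply: bmeas_integrable; exact: bmeas_cst.
Qed.

End BoundedMeasurable.

Section BoundedFubini.
Context {R : realType} {d1 d2} {T1 : measurableType d1} {T2 : measurableType d2}.
Variables (P1 : probability T1 R) (P2 : probability T2 R).
Implicit Type f : T1 * T2 -> R.

Lemma bmeas_integrable_prod f : bmeas f -> (P1 \x P2)%E.-integrable setT (EFin \o f).
Proof.
move=> [mf [M fM]]; apply: measurable_bounded_integrable => //.
  rewrite -setXTT [X in (X < _)%E](_ : _ = P1 setT * P2 setT)%E; last exact: product_measure1E.
  by rewrite !probability_setT mul1e ltry.
by exists M; split; [exact: num_real|move=> x Mx y _; exact: le_trans (fM y) (ltW Mx)].
Qed.

Lemma bmeas_pair1 f x : bmeas f -> bmeas (fun y => f (x, y)).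
Proof. by move=> bf; apply: (@bmeas_comp _ _ (T1 * T2)%type _ _ (fun y => (x, y)) f _ bf); exact: measurable_fun_pair. Qed.

Lemma bmeas_pair2 f y : bmeas f -> bmeas (fun x => f (x, y)).
Proof. by move=> bf; apply: (@bmeas_comp _ _ (T1 * T2)%type _ _ (fun x => (x, y)) f _ bf); exact: measurable_fun_pair. Qed.

Lemma bmeas_Rintegral1 f : bmeas f -> bmeas (fun x => \int[P2]_y f (x, y)).
Proof.
move=> bf; have [mf [M fM]] := bf; split; last first.
  exists M => x; apply: bmeas_Rintegral_norm => //; by case: (bmeas_pair1 x bf).
apply: measurableT_comp => //.
exact: (measurable_fubini_F (bmeas_integrable_prod bf)).
Qed.

Lemma bmeas_Rintegral2 f : bmeas f -> bmeas (fun y => \int[P1]_x f (x, y)).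
Proof.
move=> bf; have [mf [M fM]] := bf; split; last first.
  exists M => x; apply: bmeas_Rintegral_norm => //; by case: (bmeas_pair2 x bf).
apply: measurableT_comp => //.
exact: (measurable_fubini_G (bmeas_integrable_prod bf)).
Qed.

Lemma Rintegral_prod f : bmeas f ->
  \int[(P1 \x P2)%E]_z f z = \int[P1]_x \int[P2]_y f (x, y).
Proof.
move=> bf; rewrite [LHS]/Rintegral -integral12_prod_meas1//; last exact: bmeas_integrable_prod.
rewrite /Rintegral; congr fine; apply: eq_integral => x _.
by rewrite /fubini_F/= EFin_Rintegral//; exact/bmeas_integrable/bmeas_pair1.
Qed.

Lemma RFubini f : bmeas f ->
  \int[P1]_x \int[P2]_y f (x, y) = \int[P2]_y \int[P1]_x f (x, y).
Proof.
move=> bf; have fi := bmeas_integrable_prod bf.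
have /(congr1 fine) := Fubini fi.
rewrite (eq_integral (fun x => (\int[P2]_y f (x, y))%:E)); last first.
  by move=> x _; rewrite /= EFin_Rintegral//; exact/bmeas_integrable/bmeas_pair1.
rewrite [X in _ = fine X -> _](eq_integral (fun y => (\int[P1]_x f (x, y))%:E))//.
by move=> x _; rewrite /= EFin_Rintegral//; exact/bmeas_integrable/bmeas_pair2.
Qed.

End BoundedFubini.

(** * The standard Gaussian density *)

Section GaussDensity.
Context {R : realType}.
Local Notation leb := (@lebesgue_measure R).

(* [normal_prob] lives on [measurableTypeR R], whose measurable sets are those
   of [R] but whose display differs; [gauss] is the same measure on [R]. *)
Definition idTR : measurableTypeR R -> R := idfun.

Lemma measurable_idTR : measurable_fun setT idTR.
Proof. by move=> _ Y mY; rewrite setTI. Qed.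

HB.instance Definition _ := isMeasurableFun.Build _ _ _ _ idTR measurable_idTR.

Definition gauss : probability R R := distribution (normal_prob (0 : R) 1) idTR.

Definition gpdf : R -> R := normal_pdf (0 : R) 1.

Lemma gpdfE x : gpdf x = normal_peak (1 : R) * expR (- (x ^+ 2 / 2)).
Proof.
rewrite /gpdf normal_pdfE ?oner_neq0// /normal_fun subr0 expr1n mulNr.
by rewrite -mulr_natr mul1r.
Qed.

Lemma peak_gt0 : 0 < normal_peak (1 : R). Proof. exact: normal_peak_gt0. Qed.

Lemma peak_le1 : normal_peak (1 : R) <= 1.
Proof.
rewrite /normal_peak expr1n mul1r invf_le1; last first.
  by rewrite sqrtr_gt0 mulrn_wgt0// pi_gt0.
rewrite -[leLHS]sqrtr1 ler_sqrt//.
  by rewrite mulr2n; have := @pi_ge2 R; lra.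
by rewrite mulrn_wge0// pi_ge0.
Qed.

Lemma gpdf_ge0 x : 0 <= gpdf x. Proof. exact: normal_pdf_ge0. Qed.

Lemma measurable_gpdf : measurable_fun setT gpdf.
Proof. exact: measurable_normal_pdf. Qed.

Lemma continuous_gpdf : continuous gpdf.
Proof. by apply: continuous_normal_pdf; exact: oner_neq0. Qed.

(** [gpdf] and the Radon-Nikodym derivative of the normal law have the same integral over every
    measurable set, hence agree almost everywhere. *)
Lemma ge0_integral_gauss (f : R -> \bar R) : measurable_fun setT f ->
  (forall x, 0 <= f x)%E ->
  (\int[gauss]_x f x = \int[leb]_x (f x * (gpdf x)%:E))%E.
Proof.
move=> mf f0; rewrite /gauss ge0_integral_distribution//.
have dom := normal_prob_dominates (0 : R) 1.
rewrite -(Radon_Nikodym_SigmaFinite.change_of_variables dom)//.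
have mRN : measurable_fun setT (Radon_Nikodym_SigmaFinite.f (normal_prob (0 : R) 1) leb).
  exact: measurable_int (Radon_Nikodym_SigmaFinite.f_integrable dom).
have mpdf : measurable_fun setT (EFin \o gpdf).
  by apply/measurable_EFinP; exact: measurable_gpdf.
apply: ge0_ae_eq_integral => //.
- exact: emeasurable_funM.
- exact: emeasurable_funM.
- by move=> x _; rewrite mule_ge0//; exact: Radon_Nikodym_SigmaFinite.f_ge0.
- by move=> x _; rewrite mule_ge0// lee_fin gpdf_ge0.
apply: ae_eqe_mul2l; apply: integral_ae_eq => //.
  exact: Radon_Nikodym_SigmaFinite.f_integrable.
by move=> E _ mE; rewrite -Radon_Nikodym_SigmaFinite.f_integral.
Qed.

Lemma integrable_gauss (f : R -> R) : measurable_fun setT f ->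
  leb.-integrable setT (fun x => (f x * gpdf x)%:E) ->
  gauss.-integrable setT (EFin \o f).
Proof.
move=> mf /integrableP[_ fi]; apply/integrableP; split; first exact/measurable_EFinP.
rewrite ge0_integral_gauss//; last first.
  by apply: measurableT_comp => //; exact/measurable_EFinP.
under eq_integral do rewrite /= -EFinM -{1}(ger0_norm (gpdf_ge0 _)) -normrM.
exact: fi.
Qed.

Lemma Rintegral_gauss (f : R -> R) : measurable_fun setT f ->
  \int[gauss]_x f x = \int[leb]_x (f x * gpdf x).
Proof.
move=> mf; congr fine; rewrite integralE [RHS]integralE.
rewrite !ge0_integral_gauss//; last 2 first.
  by apply: measurable_funeneg; exact/measurable_EFinP.
  by apply: measurable_funepos; exact/measurable_EFinP.
congr (_ - _)%E; apply: eq_integral => x _.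
  rewrite !funeposE -EFin_max -EFinM -[RHS]EFin_max; congr EFin.
  by rewrite maxr_pMl ?gpdf_ge0// mul0r.
rewrite !funenegE -!EFinN -EFin_max -EFinM -[RHS]EFin_max; congr EFin.
by rewrite maxr_pMl ?gpdf_ge0// mul0r mulNr.
Qed.

(** On [[- n - 1, n + 1]] the fundamental theorem of calculus leaves boundary terms of size
    [O(1 / n)] by the decay of [Gam]; dominated convergence passes to the whole line. *)
Lemma Rintegral_derive0 (g Gam : R -> R) (M : R) :
  (forall x : R, is_derive x 1 Gam (g x)) -> continuous g ->
  leb.-integrable setT (EFin \o g) -> (forall x, `|x| * `|Gam x| <= M) ->
  \int[leb]_x g x = 0.
Proof.
move=> dG cg ig GM.
pose D (n : nat) : set R := `[- n.+1%:R, n.+1%:R]%classic.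
have cG : continuous Gam.
  by move=> x; apply: differentiable_continuous; apply/derivable1_diffP; exact: (@ex_derive _ _ _ _ _ _ _ (dG x)).
have ID n : (\int[leb]_(x in D n) (g x)%:E = (Gam n.+1%:R - Gam (- n.+1%:R))%:E)%E.
  rewrite (@continuous_FTC2 _ g Gam)//.
  - by rewrite -subr_gt0 opprK addr_gt0.
  - exact: continuous_subspaceT.
  - split.
    + by move=> x _; exact: (@ex_derive _ _ _ _ _ _ _ (dG x)).
    + exact/cvg_at_right_filter/cG.
    + exact/cvg_at_left_filter/cG.
  - by move=> x _; rewrite derive1E; exact: (@derive_val _ _ _ _ _ _ _ (dG x)).
have lim0 : (\int[leb]_(x in D n) (g x)%:E)%E @[n --> \oo] --> 0%E.
  under eq_fun do rewrite ID.
  apply: cvg_EFin; first exact: nearW.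
  apply: norm_cvg0; apply: (@squeeze_cvgr _ _ _ _ (fun=> 0) (fun n => 2 * M * harmonic n)).
  - near=> n; rewrite normr_ge0/= (le_trans (ler_normB _ _))//.
    have n0 : 0 < n.+1%:R :> R by [].
    have := GM n.+1%:R; have := GM (- n.+1%:R).
    rewrite normrN ger0_norm// => h1 h2.
    by rewrite /= ler_pdivlMr// mulrDl; lra.
  - exact: cvg_cst.
  - by rewrite -[X in _ --> X](mulr0 (2 * M)); apply: cvgM; [exact: cvg_cst|exact: cvg_harmonic].
have limI : (\int[leb]_(x in D n) (g x)%:E)%E @[n --> \oo] --> (\int[leb]_x (g x)%:E)%E.
  under eq_fun do rewrite integral_mkcond.
  apply: (@dominated_cvg _ _ _ leb setT measurableT _ _ (fun x => `|(g x)%:E|)%E) => //.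
  - move=> n; apply/(measurable_restrictT _ _).1 => //.
      exact: measurable_itv.
    by apply: (measurable_funS measurableT) => //; exact: measurable_int ig.
  - move=> x _; apply: cvg_near_cst; near=> n.
    rewrite patchE mem_set// /D/= in_itv/= -ler_norml.
    have : `|x| <= (Num.truncn `|x|).+1%:R by exact/ltW/truncnS_gt.
    move=> /le_trans; apply; rewrite ler_nat ltnS.
    by near: n; exact: nbhs_infty_ge.
  - exact: integrable_abse.
  - by move=> n x _; rewrite patchE; case: ifPn => // _; rewrite abse0.
by rewrite /Rintegral (cvg_unique _ limI lim0).
Unshelve. all: by end_near. Qed.

(** With [u = x^2 / 8] the claim is [(1 + 64 u^2) exp (- 2 u) <= 64], a consequence of
    [(1 + u) exp (- u) <= 1]. Half of the Gaussian exponent absorbs the polynomial; the rest is a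
    multiple of the normal density of variance [2]. *)
Lemma growth_expR (x : R) : (1 + x ^+ 4) * expR (- (x ^+ 2 / 2)) <= 64 * expR (- (x ^+ 2 / 4)).
Proof.
set u := x ^+ 2 / 8.
have u0 : 0 <= u by rewrite divr_ge0 ?sqr_ge0.
have -> : x ^+ 2 / 2 = u + u + (x ^+ 2 / 4) by rewrite /u; lra.
rewrite opprD expRD mulrA ler_pM2r ?expR_gt0// opprD expRD.
have h1 : expR (- u) * (1 + u) <= 1.
  by rewrite -ler_pdivlMl ?expR_gt0// mulr1 -expRN opprK expR_ge1Dx.
have e0 := expR_ge0 (- u).
have x4 : x ^+ 4 = 64 * u ^+ 2 by rewrite /u; lra.
rewrite x4; have : (expR (- u) * (1 + u)) ^+ 2 <= 1.
  by rewrite expr_le1// mulr_ge0// addr_ge0.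
have : 0 <= expR (- u) ^+ 2 * u by rewrite mulr_ge0// sqr_ge0.
have : 0 <= expR (- u) ^+ 2 by rewrite sqr_ge0.
rewrite exprMn; set e := expR (- u) => *; nra.
Qed.

Lemma integrable_gpdf_growth (f : R -> R) (M : R) : measurable_fun setT f ->
  (forall x, `|f x| <= M * (1 + x ^+ 4)) ->
  leb.-integrable setT (fun x => (f x * gpdf x)%:E).
Proof.
move=> mf fM.
have s20 : Num.sqrt (2 : R) != 0 by rewrite gt_eqF// sqrtr_gt0.
have pE x : normal_pdf (0 : R) (Num.sqrt 2) x =
    normal_peak (Num.sqrt (2 : R)) * expR (- (x ^+ 2 / 4)).
  rewrite normal_pdfE// /normal_fun subr0 sqr_sqrtr// mulNr.
  by congr (_ * expR (- (_ / _))); rewrite -mulr_natr -natrM.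
have p0 : 0 < normal_peak (Num.sqrt (2 : R)) by exact: normal_peak_gt0.
pose C : R := `|M| * 64 / normal_peak (Num.sqrt (2 : R)).
apply: (@le_integrable _ _ _ leb _ measurableT _
  (fun x => C%:E * (normal_pdf (0 : R) (Num.sqrt 2) x)%:E)%E).
- by apply/measurable_EFinP; apply: measurable_funM => //; exact: measurable_gpdf.
- move=> x _; rewrite -EFinM !abse_EFin lee_fin /= normrM (ger0_norm (gpdf_ge0 x)).
  rewrite pE gpdfE [leRHS]ger0_norm; last first.
    by rewrite !mulr_ge0// ?invr_ge0 ?(ltW p0)// expR_ge0.
  rewrite [leRHS]mulrA divfK ?gt_eqF//.
  have e0 := expR_ge0 (- (x ^+ 2 / 2)).
  rewrite [leLHS]mulrA [leLHS]mulrAC (le_trans (ler_piMr _ peak_le1)) ?mulr_ge0//.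
  rewrite (le_trans (ler_wpM2r e0 (fM x)))// -mulrA -[leRHS]mulrA.
  apply: (@le_trans _ _ (`|M| * ((1 + x ^+ 4) * expR (- (x ^+ 2 / 2))))).
    rewrite ler_wpM2r ?ler_norm// mulr_ge0// addr_ge0//.
    by rewrite (exprM x 2 2) sqr_ge0.
  by rewrite ler_wpM2l// growth_expR.
- by apply: integrableZl => //; exact: integrable_normal_pdf.
Qed.

Lemma integrable_gauss_growth (f : R -> R) (M : R) : measurable_fun setT f ->
  (forall x, `|f x| <= M * (1 + x ^+ 4)) ->
  gauss.-integrable setT (EFin \o f).
Proof.
by move=> mf fM; apply: integrable_gauss => //; exact: integrable_gpdf_growth fM.
Qed.

End GaussDensity.

(** * Gaussian integration by parts and moments *)

Section GaussFacts.
Context {R : realType}.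

Lemma is_derive_Rintegral {d} {T : measurableType d} (P : probability T R)
  (f f' : R -> T -> R) (G : T -> R) (a : R) :
  (forall (x : R) y, is_derive x 1 (f ^~ y) (f' x y)) ->
  (forall x, P.-integrable setT (EFin \o f x)) ->
  P.-integrable setT (EFin \o G) ->
  (forall x y, `|f' x y| <= G y) ->
  is_derive a 1 (fun x => \int[P]_y f x y) (\int[P]_y f' a y).
Proof.
move=> df fi Gi f'G.
have d1E x y : partial1of2 f x y = f' x y.
  by rewrite partial1of2E; exact: (@derive_val _ _ _ _ _ _ _ (df x y)).
have Ia : `](a - 1), (a + 1)[%classic a by rewrite /= in_itv/=; apply/andP; split; lra.
have der : forall x y, `](a - 1), (a + 1)[%classic x -> setT y -> derivable (f ^~ y) x 1.
  by move=> x y _ _; exact: (@ex_derive _ _ _ _ _ _ _ (df x y)).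
have G0 y : 0 <= G y by exact: le_trans (f'G a y).
have ub : forall x y, `](a - 1), (a + 1)[%classic x -> setT y -> `|partial1of2 f x y| <= G y.
  by move=> x y _ _; rewrite d1E.
split.
  exact: (derivable_under_integral measurableT Ia (fun x _ => fi x) der G0 Gi ub).
have := differentiation_under_integral measurableT Ia (fun x _ => fi x) der G0 Gi ub.
by rewrite derive1E => ->; apply: eq_Rintegral => y _; rewrite d1E.
Qed.

Lemma is_derive_gpdf (x : R) : is_derive x 1 (@gpdf R) (- x * gpdf x).
Proof.
have -> : @gpdf R = (fun x => normal_peak (1 : R) * expR (- (x ^+ 2 / 2))).
  by apply/funext => y; exact: gpdfE.
have h : is_derive x 1 (fun x : R => - (x ^+ 2 / 2)) (- x).
  have -> : (fun x : R => - (x ^+ 2 / 2)) = - (2^-1 \*: (@id R ^+ 2)).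
    by apply/funext => y; rewrite !fctE /GRing.scale/= mulrC.
  by apply: is_derive_eq; rewrite /GRing.scale/=; field.
have h2 := @is_derive1_comp R expR _ x _ _ (is_derive_expR _) h.
have h3 := @is_deriveZ _ _ _ _ (normal_peak (1 : R)) _ _ _ h2.
have -> : (fun y : R => normal_peak 1 * expR (- (y ^+ 2 / 2))) =
  normal_peak 1 \*: (expR \o (fun x : R => - (x ^+ 2 / 2))) by [].
apply: (is_derive_eq h3); rewrite /GRing.scale/=; ring.
Qed.

(** Stein's identity: [(F' x - x F x) gpdf x] is the derivative of [F x gpdf x], so
    [Rintegral_derive0] applies. The bound on [x F x] serves twice, for integrability and for decay
    at infinity. *)
Lemma gauss_stein (F F' : R -> R) (M : R) :
  (forall x : R, is_derive x 1 F (F' x)) -> continuous F' ->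
  (forall x, `|F' x| <= M * (1 + x ^+ 4)) ->
  (forall x, `|x * F x| <= M * (1 + x ^+ 4)) ->
  \int[gauss]_x F' x = \int[gauss]_x (x * F x).
Proof.
move=> dF cF' F'M FM.
have cF : continuous F.
  by move=> x; apply: differentiable_continuous; apply/derivable1_diffP; exact: (@ex_derive _ _ _ _ _ _ _ (dF x)).
have mF' : measurable_fun setT F' by exact: continuous_measurable_fun.
have mxF : measurable_fun setT (fun x : R => x * F x).
  by apply: measurable_funM => //; exact: continuous_measurable_fun.
have iF' := integrable_gauss_growth mF' F'M.
have ixF := integrable_gauss_growth mxF FM.
apply/eqP; rewrite -subr_eq0 -RintegralB//; apply/eqP.
rewrite Rintegral_gauss; last exact: measurable_funB.
apply: (@Rintegral_derive0 _ _ (fun x => F x * gpdf x) (`|M| * 64)).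
- move=> x; have := @is_deriveM _ _ _ _ _ _ _ _ (dF x) (is_derive_gpdf x).
  by move=> h; apply: (is_derive_eq h); rewrite /GRing.scale/=; ring.
- move=> x; apply: cvgM; last exact: continuous_gpdf.
  by apply: cvgB; [exact: cF'|apply: cvgM; [exact: cvg_id|exact: cF]].
- apply: (@integrable_gpdf_growth _ (fun x : R => F' x - x * F x) (M + M)).
    exact: measurable_funB.
  by move=> x; rewrite (le_trans (ler_normB _ _))// mulrDl lerD.
- move=> x; rewrite -normrM mulrA normrM (ger0_norm (gpdf_ge0 x)) gpdfE.
  have e0 := expR_ge0 (- (x ^+ 2 / 2)).
  have x4 : 0 <= 1 + x ^+ 4 by rewrite addr_ge0// (exprM x 2 2) sqr_ge0.
  apply: (@le_trans _ _ (`|M| * (1 + x ^+ 4) * expR (- (x ^+ 2 / 2)))).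
    rewrite ler_pM// ?mulr_ge0 ?(ltW peak_gt0)//.
      by rewrite (le_trans (FM x))// ler_wpM2r// ler_norm.
    by rewrite ler_piMl// peak_le1.
  rewrite -mulrA ler_wpM2l// (le_trans (growth_expR x))// ler_piMr//.
  by rewrite -expR0 ler_expR oppr_le0 divr_ge0// sqr_ge0.
Qed.

Lemma sqr_growth (x : R) : x ^+ 2 <= 1 + x ^+ 4.
Proof.
have -> : x ^+ 4 = (x ^+ 2) ^+ 2 by rewrite -exprM.
by have := sqr_ge0 x; have := sqr_ge0 (x ^+ 2 - 1); set y := x ^+ 2; nra.
Qed.

Lemma norm_growth (x : R) : `|x| <= 1 + x ^+ 4.
Proof.
have := sqr_ge0 (`|x| - 1); rewrite sqrrB1 real_normK ?num_real//.
have := sqr_ge0 (x ^+ 2 - 2^-1).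
have -> : x ^+ 4 = (x ^+ 2) ^+ 2 by rewrite -exprM.
by set y := x ^+ 2; rewrite -mulr_natr => h1 h2; nra.
Qed.

Lemma gauss_integrable_norm : gauss.-integrable setT (fun x : R => `|x|%:E).
Proof.
apply: (@integrable_gauss_growth _ (fun x => `|x|) 1); first exact: measurableT_comp.
by move=> x; rewrite normr_id mul1r norm_growth.
Qed.

Lemma gauss_integrable_sqr : gauss.-integrable setT (fun x : R => (x ^+ 2)%:E).
Proof.
apply: (@integrable_gauss_growth _ (fun x => x ^+ 2) 1); first exact: measurable_funX.
by move=> x; rewrite ger0_norm ?sqr_ge0// mul1r sqr_growth.
Qed.

Lemma gauss_sqr : \int[gauss]_x (x ^+ 2) = 1 :> R.
Proof.
have := @gauss_stein id (fun=> 1) 1 (fun x => is_derive_id x 1).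
rewrite Rintegral_cstT => ->.
- by apply: eq_Rintegral => x _; rewrite expr2.
- exact: cst_continuous.
- by move=> x; rewrite normr1 mul1r lerDl (exprM x 2 2) sqr_ge0.
- by move=> x; rewrite mul1r normrM -expr2 real_normK ?num_real// sqr_growth.
Qed.

Lemma gauss_norm_le1 : \int[gauss]_x `|x| <= 1 :> R.
Proof.
have i1 : gauss.-integrable setT (fun x : R => (x ^+ 2 + 1)%:E).
  by apply: intRD; [exact: gauss_integrable_sqr|exact/bmeas_integrable/bmeas_cst].
have -> : 1 = \int[gauss]_x (2^-1 * (x ^+ 2 + 1)) :> R.
  rewrite RintegralZl// RintegralD//; last exact/bmeas_integrable/bmeas_cst.
    by rewrite gauss_sqr Rintegral_cstT; lra.
  exact: gauss_integrable_sqr.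
apply: le_Rintegral => //; first exact: gauss_integrable_norm.
  exact: intRZl i1.
move=> x _; have := sqr_ge0 (`|x| - 1); rewrite sqrrB1 real_normK ?num_real//.
by rewrite -mulr_natr; lra.
Qed.

Lemma gauss_var0 : \int[gauss]_x (x ^+ 2 - 1) = 0 :> R.
Proof.
rewrite RintegralB//; last exact/bmeas_integrable/bmeas_cst.
  by rewrite gauss_sqr Rintegral_cstT subrr.
exact: gauss_integrable_sqr.
Qed.

Lemma gauss_integrable_var : gauss.-integrable setT (fun x : R => (x ^+ 2 - 1)%:E).
Proof.
by apply: intRB; [exact: gauss_integrable_sqr|exact/bmeas_integrable/bmeas_cst].
Qed.

Lemma gauss_integrable_var2 :
  gauss.-integrable setT (fun x : R => ((x ^+ 2 - 1) ^+ 2)%:E).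
Proof.
apply: (@integrable_gauss_growth _ (fun x => (x ^+ 2 - 1) ^+ 2) 2).
  by apply: measurable_funX; apply: measurable_funB.
move=> x; rewrite ger0_norm ?sqr_ge0//.
have := sqr_ge0 (x ^+ 2 + 1); have -> : x ^+ 4 = (x ^+ 2) ^+ 2 by rewrite -exprM.
by set y := x ^+ 2; nra.
Qed.

(** As a function of [t] the left side satisfies [h' = - t h], by Stein's identity for
    [sin (a + t w)], so [h t exp (t^2 / 2)] is constant. The phase [a] allows an induction on the
    dimension, and [a = - pi / 2] gives the sine. *)
Lemma gauss_cos (a t : R) :
  \int[gauss]_w cos (a + t * w) = cos a * expR (- (t ^+ 2 / 2)).
Proof.
pose h t := \int[gauss]_w cos (a + t * w).
have lin (b c : R) (x : R) : is_derive x 1 (fun t => b + t * c) c.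
  have -> : (fun t => b + t * c) = cst b + c \*: (@id R).
    by apply/funext => y; rewrite !fctE /GRing.scale/= mulrC.
  by apply: is_derive_eq; rewrite /GRing.scale/=; ring.
have lin' (b c : R) (x : R) : is_derive x 1 (fun t => b + c * t) c.
  by under eq_fun do rewrite mulrC; exact: lin.
have dh (x : R) : is_derive x 1 h (- x * h x).
  have -> : - x * h x = \int[gauss]_w (- w * sin (a + x * w)).
    transitivity (- \int[gauss]_w (x * cos (a + x * w))).
      rewrite RintegralZl//; first by rewrite mulNr.
      by apply/bmeas_integrable/bmeas_cos; apply: measurable_funD => //; exact: measurable_funM.
    transitivity (- \int[gauss]_w (w * sin (a + x * w))); last first.
      rewrite -mulN1r -RintegralZl//.
        by apply: eq_Rintegral => w _; rewrite mulN1r mulNr.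
      apply: (@integrable_gauss_growth _ (fun w => w * sin (a + x * w)) 1).
        apply: measurable_funM => //; apply: (proj1 (bmeas_sin _)).
        by apply: measurable_funD => //; exact: measurable_funM.
      move=> w; rewrite mul1r normrM (le_trans _ (norm_growth w))// ler_piMr//.
      by rewrite ler_norml sin_geN1 sin_le1.
    congr (- _).
    apply: (@gauss_stein (fun w => sin (a + x * w)) (fun w => x * cos (a + x * w)) (`|x| + 1)).
    - by move=> w; rewrite mulrC; exact: (@is_derive1_comp R sin _ w _ _ _ (lin' a x w)).
    - move=> w; apply: cvgM; first exact: cvg_cst.
      apply: continuous_comp; last exact: continuous_cos.
      by apply: cvgD; [exact: cvg_cst|apply: cvgM; [exact: cvg_cst|exact: cvg_id]].
    - move=> w; rewrite normrM.
      have x4 : 0 <= w ^+ 4 by rewrite (exprM w 2 2) sqr_ge0.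
      rewrite (@le_trans _ _ (`|x| * 1)) ?ler_wpM2l ?cos_max//.
      by rewrite ler_pM//; lra.
    - move=> w; rewrite normrM.
      rewrite (@le_trans _ _ (`|w| * 1)) ?ler_wpM2l ?sin_max//.
      rewrite mulr1 (le_trans (norm_growth w))// ler_peMl//.
        by rewrite addr_ge0// (exprM w 2 2) sqr_ge0.
      by rewrite lerDr.
  apply: (@is_derive_Rintegral _ _ gauss (fun t w => cos (a + t * w)) (fun t w => - w * sin (a + t * w)) (fun w => `|w|)).
  - move=> y w; rewrite -mulrC mulrN -mulNr.
    exact: (@is_derive1_comp R cos _ y _ _ _ (lin a w y)).
  - move=> y; apply/bmeas_integrable/bmeas_cos.
    by apply: measurable_funD => //; exact: measurable_funM.
  - exact: gauss_integrable_norm.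
  - by move=> y w; rewrite normrM normrN ler_piMr// sin_max.
have dE (x : R) : is_derive x 1 (fun t : R => expR (t ^+ 2 / 2)) (x * expR (x ^+ 2 / 2)).
  have h1 : is_derive x 1 (fun x : R => x ^+ 2 / 2) x.
    have -> : (fun x : R => x ^+ 2 / 2) = 2^-1 \*: (@id R ^+ 2).
      by apply/funext => y; rewrite !fctE /GRing.scale/= mulrC.
    by apply: is_derive_eq; rewrite /GRing.scale/=; field.
  by rewrite mulrC; exact: (@is_derive1_comp R expR _ x _ _ (is_derive_expR _) h1).
have cst : h t * expR (t ^+ 2 / 2) = h 0 * expR (0 ^+ 2 / 2).
  apply: (@is_derive_0_is_cst _ (fun t => h t * expR (t ^+ 2 / 2))) => x.
  have hh := @is_deriveM _ _ _ _ _ _ _ _ (dh x) (dE x).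
  by apply: (is_derive_eq hh); rewrite /GRing.scale/=; ring.
rewrite -/(h t) expRN; apply: (@mulIf _ (expR (t ^+ 2 / 2))); first by rewrite gt_eqF ?expR_gt0.
rewrite cst expr0n/= mul0r expR0 mulr1 divfK ?gt_eqF ?expR_gt0//.
rewrite /h; under eq_Rintegral do rewrite mul0r addr0.
exact: Rintegral_cstT.
Qed.

End GaussFacts.

(** * The Gaussian distribution function *)

Section GaussCdf.
Context {R : realType}.
Local Notation leb := (@lebesgue_measure R).

(** Written as the integral of a boolean, not as the measure of a half-line, to stay within [bmeas]
    and [RFubini]. *)
Definition Phi (a : R) : R := \int[gauss]_z ((z <= a)%R)%:R.

Lemma bmeas_nat {d} {T : measurableType d} (b : T -> bool) :
  measurable_fun setT b -> bmeas (fun x => (b x)%:R : R).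
Proof.
move=> mb; split; last by exists 1 => x; case: (b x); rewrite ?normr1 ?normr0.
rewrite (_ : (fun x => _) = \1_(b @^-1` [set true])).
  by apply: measurable_indic; rewrite -[X in measurable X]setTI; exact: mb.
apply/funext => x; rewrite indicE; case: (boolP (b x)) => bx.
  by rewrite mem_set.
by rewrite memNset//=; rewrite (negbTE bx).
Qed.

Lemma bmeas_le {d} {T : measurableType d} (f g : T -> R) :
  measurable_fun setT f -> measurable_fun setT g ->
  bmeas (fun x => ((f x <= g x)%R)%:R : R).
Proof. by move=> mf mg; apply: bmeas_nat; exact: measurable_fun_ler. Qed.

Lemma is_derive_Phi (a : R) : is_derive a 1 Phi (gpdf a).
Proof.
have PhiE : Phi = fun y => \int[leb]_(t in [set` Interval -oo%O (BRight y)]) gpdf t.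
  apply/funext => y; rewrite /Phi Rintegral_gauss; last first.
    by apply: (proj1 (bmeas_le _ _)).
  rewrite [RHS]Rintegral_mkcond; apply: eq_Rintegral => x _.
  rewrite patchE mem_setE in_itv/=; case: (x <= y); first by rewrite mul1r.
  by rewrite mul0r.
have au : a < a + 1 by lra.
have ig : leb.-integrable [set` Interval -oo%O (BRight (a + 1))] (EFin \o gpdf).
  apply: (@integrableS _ _ _ leb setT) => //; exact: integrable_normal_pdf.
have an : (-oo%O < BRight a)%E by exact: ltNyr.
have [] := @continuous_FTC1 R gpdf -oo%O a (a + 1) au ig an (@continuous_gpdf R a).
by rewrite PhiE => d1 d2; split; [exact: d1|rewrite -derive1E; exact: d2].
Qed.

Lemma gpdf_le1 (x : R) : gpdf x <= 1.
Proof.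
rewrite gpdfE -[leRHS]mul1r ler_pM ?(ltW peak_gt0) ?expR_ge0 ?peak_le1//.
by rewrite -expR0 ler_expR oppr_le0 divr_ge0// sqr_ge0.
Qed.

Lemma continuous_Phi : continuous Phi.
Proof.
move=> x; apply: differentiable_continuous; apply/derivable1_diffP.
exact: (@ex_derive _ _ _ _ _ _ _ (is_derive_Phi x)).
Qed.

Lemma Phi_MVT (a b : R) : a < b ->
  exists2 c, (a < c < b)%R & Phi b - Phi a = gpdf c * (b - a).
Proof.
move=> ab; have [] := @MVT _ Phi gpdf a b ab.
- by move=> x _; exact: is_derive_Phi.
- exact/continuous_subspaceT/continuous_Phi.
by move=> c; rewrite in_itv/= => h1 h2; exists c.
Qed.

Lemma Phi_ge0 a : 0 <= Phi a. Proof. by apply: Rintegral_ge0 => x _. Qed.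

Lemma Phi_le1 a : Phi a <= 1.
Proof.
rewrite (le_trans (ler_norm _))//; apply: bmeas_Rintegral_norm.
  exact: (proj1 (bmeas_le _ _)).
by move=> x; case: (x <= a); rewrite ?normr1 ?normr0.
Qed.

Lemma Phi_lip (a b : R) : a <= b -> Phi b - Phi a <= b - a.
Proof.
rewrite le_eqVlt => /predU1P[->|ab]; first by rewrite !subrr.
by have [c _ ->] := Phi_MVT ab; rewrite ler_piMl ?gpdf_le1// subr_ge0 ltW.
Qed.

(** For [l < 1 / 2] the right side exceeds [1]. Otherwise the mean value theorem gives
    [|l - 1| |y| gpdf c] with [|c| >= |y| / 2], and the decay of [gpdf] makes [|y| gpdf c <= 2]. *)
Lemma Phi_scale (l y : R) : 0 < l -> `|Phi (l * y) - Phi y| <= 2 * `|l - 1|.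
Proof.
move=> l0; have [l2|l2] := ltP l 2^-1.
  have := Phi_ge0 (l * y); have := Phi_ge0 y; have := Phi_le1 y; have := Phi_le1 (l * y).
  rewrite (@ler0_norm _ (l - 1)); last lra.
  by rewrite ler_norml => *; apply/andP; split; lra.
have key (c : R) : `|y| / 2 <= `|c| -> `|y| * gpdf c <= 2.
  move=> yc; rewrite gpdfE.
  have e0 := expR_ge0 (- (c ^+ 2 / 2)).
  have h1 : expR (- (c ^+ 2 / 2)) * (1 + c ^+ 2 / 2) <= 1.
    by rewrite -ler_pdivlMl ?expR_gt0// mulr1 -expRN opprK expR_ge1Dx.
  have y2 : `|y| <= 2 * (1 + c ^+ 2 / 2).
    have := sqr_ge0 (`|c| - 1); rewrite sqrrB1 real_normK ?num_real// -mulr_natr; lra.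
  rewrite mulrCA (@le_trans _ _ (1 * (`|y| * expR (- (c ^+ 2 / 2)))))//.
    by rewrite ler_wpM2r ?peak_le1// mulr_ge0.
  rewrite mul1r (le_trans (ler_wpM2r e0 y2))//.
  by rewrite mulrC mulrCA; lra.
have [yl|yl|<-] := ltgtP y (l * y); last by rewrite subrr normr0 mulr_ge0.
- have [c /andP[c1 c2] ->] := Phi_MVT yl.
  rewrite normrM (ger0_norm (gpdf_ge0 c)).
  have -> : l * y - y = (l - 1) * y by ring.
  rewrite normrM mulrCA mulrC ler_wpM2r// mulrC key//.
  have [y0|y0] := leP 0 y.
    by rewrite !ger0_norm//; lra.
  have ly : l * y <= y / 2 by nra.
  by rewrite !ler0_norm//; lra.
- have [c /andP[c1 c2]] := Phi_MVT yl; rewrite distrC => ->.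
  rewrite normrM (ger0_norm (gpdf_ge0 c)).
  have -> : y - l * y = - (l - 1) * y by ring.
  rewrite normrM normrN mulrCA mulrC ler_wpM2r// mulrC key//.
  have [y0|y0] := leP 0 y.
    have ly : y / 2 <= l * y by nra.
    by rewrite !ger0_norm//; lra.
  by rewrite !ltr0_norm//; lra.
Qed.

End GaussCdf.

(** * Fourier inversion for the normal distribution function *)

Section GaussSinc.
Context {R : realType}.
Local Notation leb := (@lebesgue_measure R).

(** The inverse, discontinuous at [0], is written [y exp (- ln (y^2))], which also gives its default
    value [0] at [y = 0]. *)
Lemma measurable_funV {d} {T : measurableType d} (f : T -> R) :
  measurable_fun setT f -> measurable_fun setT (fun x => (f x)^-1).
Proof.
move=> mf; have -> : (fun x => (f x)^-1) = (fun x => f x * expR (- ln (f x ^+ 2))).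
  apply/funext => x; have [->|x0] := eqVneq (f x) 0; first by rewrite invr0 mul0r.
  rewrite expRN lnK ?posrE ?exprn_even_gt0//.
  by rewrite expr2 invfM mulrA divff// mul1r.
apply: measurable_funM => //; apply: measurableT_comp => //.
apply: measurableT_comp => //; apply: measurableT_comp; first exact: measurable_ln.
exact: measurable_funX.
Qed.

Lemma sin_norm_le (x : R) : `|sin x| <= `|x|.
Proof.
wlog x0 : x / 0 <= x => [wl|].
  have [/wl//|/ltW x0] := leP 0 x.
  by rewrite -normrN -[leRHS]normrN -sinN wl// oppr_ge0.
have [c _] := @MVT_segment _ sin cos 0 x x0 (fun y _ => is_derive_sin y)
  (continuous_subspaceT (@continuous_sin R)).
by rewrite sin0 !subr0 => ->; rewrite normrM ler_piMl// cos_max.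
Qed.

Lemma gauss_set0 : gauss [set (0 : R)%R] = 0%E.
Proof.
rewrite -[LHS](_ : \int[gauss]_(x in [set (0 : R)%R]) 1%E = _)%E; last first.
  by rewrite integral_cst// mul1e.
rewrite integral_mkcond ge0_integral_gauss//.
- transitivity (\int[leb]_(x in [set 0%R]) (gpdf x)%:E)%E; last by rewrite integral_set1.
  rewrite [RHS]integral_mkcond; apply: eq_integral => x _.
  by rewrite !patchE; case: ifPn => _; rewrite ?mul1e ?mul0e.
- by apply/(measurable_restrictT _ _).1.
- by move=> x; rewrite patchE; case: ifP.
Qed.

(* The value at [w = 0] is the limit, so that the formula
   [d/da = cos (w * a)] has no exception. *)
Definition snc (a w : R) : R := if w == 0 then a else sin (w * a) / w.

Lemma snc_le a w : `|snc a w| <= `|a|.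
Proof.
rewrite /snc; have [//|w0] := eqVneq w 0.
by rewrite normrM normfV ler_pdivrMr ?normr_gt0// mulrC -normrM sin_norm_le.
Qed.

Lemma measurable_snc {d} {T : measurableType d} (f g : T -> R) :
  measurable_fun setT f -> measurable_fun setT g ->
  measurable_fun setT (fun x => snc (f x) (g x)).
Proof.
move=> mf mg; apply: measurable_fun_ifT => //=; first exact: measurable_fun_eqr.
apply: measurable_funM; last exact: measurable_funV.
by apply: (proj1 (bmeas_sin _)); exact: measurable_funM.
Qed.

(** Both sides vanish at [a = 0] and have the same derivative, since [E cos (w a) = exp (- a^2 / 2)]
    is proportional to [gpdf a]. The Gaussian is its own Fourier transform, so the frequency [w] is
    again distributed as [gauss]. *)
Lemma Phi_snc (a : R) :
  Phi a - Phi 0 = normal_peak (1 : R) * \int[gauss]_w snc a w.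
Proof.
have lin (c : R) (x : R) : is_derive x 1 (fun t => c * t) c.
  have -> : (fun t => c * t) = c \*: (@id R) by apply/funext => y.
  by apply: is_derive_eq; rewrite /GRing.scale/=; ring.
have isnc x : gauss.-integrable setT (EFin \o snc x).
  by apply: bmeas_integrable; split; [exact: measurable_snc|exists `|x| => w; exact: snc_le].
have dS (x : R) : is_derive x 1 (fun a => \int[gauss]_w snc a w) (expR (- (x ^+ 2 / 2))).
  have -> : expR (- (x ^+ 2 / 2)) = \int[gauss]_w cos (w * x).
    have := gauss_cos 0 x; rewrite cos0 mul1r => <-.
    by apply: eq_Rintegral => w _; rewrite add0r mulrC.
  apply: (@is_derive_Rintegral _ _ _ gauss snc (fun a w => cos (w * a)) (fun=> 1)).
  - move=> y w; rewrite /snc; have [->|w0] := eqVneq w 0.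
      by rewrite mul0r cos0; exact: is_derive_id.
    have h := @is_deriveZ _ _ _ _ w^-1 _ _ _
      (@is_derive1_comp R sin _ y _ _ (is_derive_sin _) (lin w y)).
    have -> : (fun t => sin (w * t) / w) = w^-1 \*: (sin \o (fun t => w * t)).
      by apply/funext => t; rewrite !fctE /GRing.scale/= mulrC.
    by apply: (is_derive_eq h); rewrite /GRing.scale/= mulrCA mulVf ?mulr1.
  - exact: isnc.
  - exact/bmeas_integrable/bmeas_cst.
  - by move=> y w; exact: cos_max.
pose D a := Phi a - normal_peak (1 : R) * \int[gauss]_w snc a w.
have DE : D a = D 0.
  apply: (@is_derive_0_is_cst _ D) => x.
  have h := @is_deriveB _ _ _ _ _ _ _ _ _ (is_derive_Phi x)
     (@is_deriveZ _ _ _ _ (normal_peak (1 : R)) _ _ _ (dS x)).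
  by apply: (is_derive_eq h); rewrite gpdfE /GRing.scale/= subrr.
have D0 : D 0 = Phi 0.
  rewrite /D (_ : \int[gauss]_w snc 0 w = 0) ?mulr0 ?subr0//.
  rewrite -[RHS](Rintegral_cstT gauss); apply: eq_Rintegral => w _.
  by have := snc_le 0 w; rewrite normr0 normr_le0 => /eqP.
by rewrite -D0 -DE /D opprB addrC subrK.
Qed.

Lemma gauss_tail : \int[gauss]_z ((2 < `|z|)%R)%:R <= 4^-1 :> R.
Proof.
have -> : 4^-1 = \int[gauss]_z (4^-1 * z ^+ 2) :> R.
  by rewrite RintegralZl ?gauss_sqr ?mulr1//; exact: gauss_integrable_sqr.
apply: le_Rintegral => //.
- by apply/bmeas_integrable/bmeas_nat; apply: measurable_fun_ltr => //; exact: measurableT_comp.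
- exact: intRZl gauss_integrable_sqr.
move=> z _; case: (ltP 2 `|z|) => /= z2; last by rewrite mulr_ge0 ?sqr_ge0.
have : 0 <= (`|z| - 2) * (`|z| + 2) by rewrite mulr_ge0//; lra.
have -> : (`|z| - 2) * (`|z| + 2) = `|z| ^+ 2 - 4 by ring.
by rewrite real_normK ?num_real//; lra.
Qed.

(** As [gpdf <= 1], the Lebesgue integral is an upper bound; by symmetry it is twice that over the
    half-line, where [- exp (- k w^2 / 2) / k] is an antiderivative. *)
Lemma gauss_kernel (k : R) : 0 < k ->
  \int[gauss]_w (`|w| * expR (- (k * (w ^+ 2 / 2)))) <= 2 / k.
Proof.
move=> k0; pose f (w : R) := `|w| * expR (- (k * (w ^+ 2 / 2))).
have f0 w : 0 <= f w by rewrite mulr_ge0// expR_ge0.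
have cE : continuous (fun w : R => expR (- (k * (w ^+ 2 / 2)))).
  move=> w; apply: continuous_comp; last exact: continuous_expR.
  apply: continuous_comp; last exact: opp_continuous.
  by apply: cvgM; [exact: cvg_cst|apply: cvgM; [exact: exprn_continuous|exact: cvg_cst]].
have cf : continuous f.
  by move=> w; apply: cvgM; [exact: norm_continuous|exact: cE].
have mf : measurable_fun setT f by exact: continuous_measurable_fun.
have dE (w : R) : is_derive w 1 (fun w => - k^-1 * expR (- (k * (w ^+ 2 / 2))))
    (w * expR (- (k * (w ^+ 2 / 2)))).
  have h1 : is_derive w 1 (fun w : R => - (k * (w ^+ 2 / 2))) (- (k * w)).
    have -> : (fun w : R => - (k * (w ^+ 2 / 2))) = (- (k / 2)) \*: (@id R ^+ 2).
      apply/funext => y; rewrite !fctE.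
      change (- (k * (y ^+ 2 / 2)) = - (k / 2) * y ^+ 2); by field.
    by apply: is_derive_eq; rewrite /GRing.scale/=; field.
  have h2 := @is_deriveZ _ _ _ _ (- k^-1) _ _ _
     (@is_derive1_comp R expR _ w _ _ (is_derive_expR _) h1).
  have -> : (fun w => - k^-1 * expR (- (k * (w ^+ 2 / 2)))) =
    - k^-1 \*: (expR \o (fun w : R => - (k * (w ^+ 2 / 2)))) by [].
  apply: (is_derive_eq h2); rewrite /GRing.scale/=; field.
  by rewrite gt_eqF.
have I0 : (\int[leb]_(x in `[0%R, +oo[) (f x)%:E = (k^-1)%:E)%E.
  rewrite (@ge0_continuous_FTC2y _ f (fun w => - k^-1 * expR (- (k * (w ^+ 2 / 2)))) _ 0).
  - by rewrite expr0n/= mul0r mulr0 oppr0 expR0 mulr1 -EFinB sub0r opprK.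
  - by move=> x _; exact: f0.
  - exact: continuous_subspaceT.
  - rewrite -[X in _ --> X](mulr0 (- k^-1)); apply: cvgM; first exact: cvg_cst.
    apply: (cvg_comp (fun x => k * (x ^+ 2 / 2)) (fun x => expR (- x))); last exact: cvgr_expR.
    under eq_fun do rewrite mulrCA.
    have k20 : 0 < k / 2 by rewrite divr_gt0.
    exact: (gt0_cvgMly k20 (@cvgr_expr2 R)).
  - by move=> x _; exact: (@ex_derive _ _ _ _ _ _ _ (dE x)).
  - by apply: cvg_at_right_filter; apply: cvgM; [exact: cvg_cst|exact: (cE 0)].
  - move=> x; rewrite in_itv/= andbT => x0.
    by rewrite derive1E (@derive_val _ _ _ _ _ _ _ (dE x)) /f gtr0_norm.
have IT : (\int[leb]_x (f x)%:E = (2 / k)%:E)%E.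
  rewrite ge0_symfun_integralT//.
    rewrite (_ : [set x | _] = `[0%R, +oo[%classic); last first.
      by apply/seteqP; split => x/=; rewrite in_itv/= andbT.
    by rewrite I0 -EFinM.
  by move=> x; rewrite /f/= normrN sqrrN.
rewrite -lee_fin -/(f _) /Rintegral.
have le : (\int[gauss]_x (f x)%:E <= (2 / k)%:E)%E.
  rewrite -IT ge0_integral_gauss//; last exact/measurable_EFinP.
  apply: ge0_le_integral => //.
  - by move=> x _; rewrite -EFinM lee_fin mulr_ge0// gpdf_ge0.
  - apply/measurable_EFinP; apply: measurable_funM => //; exact: measurable_gpdf.
  - exact/measurable_EFinP.
  - by move=> x _; rewrite -EFinM lee_fin ler_piMr// gpdf_le1.
rewrite fineK// ge0_fin_numE ?integral_ge0//.
  by rewrite (le_lt_trans le)// ltry.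
Qed.

End GaussSinc.

(** * A smoothing inequality *)

Section Smoothing.
Context {R : realType}.

(** A gap between [F1] and [F2] at one point persists, up to [om], on a window of length [4 e] by
    monotonicity. The Gaussian average over this window sees it with weight at least [3 / 4];
    outside, the difference is no worse than [- dl], with [dl] the supremum of the gap. *)
Lemma desmoothing (F1 F2 : R -> R) (e om K : R) : 0 < e -> 0 <= om ->
  measurable_fun setT F1 -> measurable_fun setT F2 ->
  {homo F1 : x y / x <= y} -> {homo F2 : x y / x <= y} ->
  (forall x, 0 <= F1 x <= 1) -> (forall x, 0 <= F2 x <= 1) ->
  (forall x, F2 (x + 4 * e) - F2 x <= om) ->
  (forall x, `|\int[gauss]_z (F1 (x - e * z) - F2 (x - e * z))| <= K) ->
  forall x, `|F1 x - F2 x| <= 2 * K + 2 * om.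
Proof.
move=> e0 om0 mF1 mF2 nd1 nd2 b1 b2 Hom HK x.
pose S : set R := [set `|F1 y - F2 y| | y in setT].
have S1 y : `|F1 y - F2 y| <= 1.
  by have := b1 y; have := b2 y => /andP[? ?] /andP[? ?]; rewrite ler_norml; apply/andP; split; lra.
have supS : has_sup S.
  by split; [exists `|F1 x - F2 x|; exists x|exists 1 => _ [y _ <-]].
have leS y : `|F1 y - F2 y| <= sup S by apply: sup_upper_bound => //; exists y.
set dl := sup S in leS.
have dl0 : 0 <= dl by exact: le_trans (leS x).
pose q : R := \int[gauss]_z ((2 < `|z|)%R)%:R.
have bq : bmeas (fun z : R => ((2 < `|z|)%R)%:R : R).
  by apply: bmeas_nat; apply: measurable_fun_ltr => //; exact: measurableT_comp.
have q4 : q <= 4^-1 by exact: gauss_tail.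
have bF (F : R -> R) y : measurable_fun setT F -> (forall x, 0 <= F x <= 1) ->
    bmeas (fun z : R => F (y - e * z)).
  move=> mF bF; split.
    apply: (@measurableT_comp _ _ _ R R R F setT (fun z => y - e * z)) => //.
    by apply: measurable_funB => //; exact: measurable_funM.
  by exists 1 => z; have /andP[h1 h2] := bF (y - e * z); rewrite ger0_norm.
(* The integral is at least [(1 - q) D - q dl]. *)
have key (G : R -> R) (D : R) : bmeas G -> 0 < D -> (forall z, - dl <= G z) ->
    (forall z, `|z| <= 2 -> D <= G z) -> 3 / 4 * D - dl / 4 <= \int[gauss]_z G z.
  move=> bG D0 Gdl GD.
  have bc : bmeas (fun z : R => (D + dl) * ((2 < `|z|)%R)%:R).
    by apply: bmeasM => //; exact: bmeas_cst.
  apply: (@le_trans _ _ (\int[gauss]_z (D - (D + dl) * ((2 < `|z|)%R)%:R))).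
    rewrite RintegralB//; [|exact/bmeas_integrable/bmeas_cst|exact: bmeas_integrable].
    rewrite Rintegral_cstT RintegralZl//; last exact: bmeas_integrable.
    by rewrite -/q; nra.
  apply: le_Rintegral => //; [|exact: bmeas_integrable|].
    by apply/bmeas_integrable/bmeasB => //; exact: bmeas_cst.
  move=> z _; case: ltP => /= z2; first by rewrite mulr1 (le_trans _ (Gdl z))//; lra.
  by rewrite mulr0 subr0 GD.
(* The window is centred at [y + 2 e] if [F1] is larger at [y], at [y - 2 e] otherwise: [|z| <= 2]
   then keeps the argument on the side of [y] where monotonicity helps. *)
have main y : 3 / 4 * `|F1 y - F2 y| <= K + dl / 4 + 3 / 4 * om.
  have [D0|D0] := leP (F1 y - F2 y) 0.
    rewrite (ler0_norm D0); have [dom|dom] := leP (- (F1 y - F2 y)) om.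
      by rewrite (@le_trans _ _ (3 / 4 * om)) ?ler_wpM2l//; have := le_trans (normr_ge0 _) (HK 0); lra.
    have h := key (fun z => F2 (y - 2 * e - e * z) - F1 (y - 2 * e - e * z)) (- (F1 y - F2 y) - om).
    have : \int[gauss]_z (F2 (y - 2 * e - e * z) - F1 (y - 2 * e - e * z)) <= K.
      rewrite (le_trans (ler_norm _))// (le_trans _ (HK (y - 2 * e)))//.
      rewrite RintegralB//; [|exact/bmeas_integrable/bF|exact/bmeas_integrable/bF].
      rewrite [X in _ <= `|X|]RintegralB//; [|exact/bmeas_integrable/bF|exact/bmeas_integrable/bF].
      by rewrite distrC.
    suff : 3 / 4 * (- (F1 y - F2 y) - om) - dl / 4 <=
      \int[gauss]_z (F2 (y - 2 * e - e * z) - F1 (y - 2 * e - e * z)) by lra.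
    apply: h.
    - by apply: bmeasB; exact: bF.
    - by rewrite subr_gt0.
    - move=> z; have := leS (y - 2 * e - e * z); rewrite ler_norml => /andP[]; lra.
    - move=> z; rewrite ler_norml => /andP[z1 z2].
      have h1 : F1 (y - 2 * e - e * z) <= F1 y by apply: nd1; nra.
      have h2 : F2 (y - 4 * e) <= F2 (y - 2 * e - e * z) by apply: nd2; nra.
      have := Hom (y - 4 * e); rewrite subrK; lra.
  rewrite (gtr0_norm D0); have [dom|dom] := leP (F1 y - F2 y) om.
    by rewrite (@le_trans _ _ (3 / 4 * om)) ?ler_wpM2l//; have := le_trans (normr_ge0 _) (HK 0); lra.
  have h := key (fun z => F1 (y + 2 * e - e * z) - F2 (y + 2 * e - e * z)) (F1 y - F2 y - om).
  have : \int[gauss]_z (F1 (y + 2 * e - e * z) - F2 (y + 2 * e - e * z)) <= K.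
    by rewrite (le_trans (ler_norm _)).
  suff : 3 / 4 * (F1 y - F2 y - om) - dl / 4 <=
    \int[gauss]_z (F1 (y + 2 * e - e * z) - F2 (y + 2 * e - e * z)) by lra.
  apply: h.
  - by apply: bmeasB; exact: bF.
  - by rewrite subr_gt0.
  - move=> z; have := leS (y + 2 * e - e * z); rewrite ler_norml => /andP[]; lra.
  - move=> z; rewrite ler_norml => /andP[z1 z2].
    have h1 : F1 y <= F1 (y + 2 * e - e * z) by apply: nd1; nra.
    have h2 : F2 (y + 2 * e - e * z) <= F2 (y + 4 * e) by apply: nd2; nra.
    have := Hom y; lra.
(* On the right [dl] has the factor [1 / 3] and is absorbed by the left side. *)
have : dl <= 4 / 3 * (K + dl / 4 + 3 / 4 * om).
  apply: ge_sup; first by case: supS.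
  by move=> _ [y _ <-]; have := main y; lra.
have := leS x; lra.
Qed.

(** The distribution function of [nu]; [lcos] and [lsin] are the real and imaginary parts of its
    characteristic function, kept apart to remain in [R]. *)
Definition lcdf (nu : probability R R) (x : R) : R := \int[nu]_y ((y <= x)%R)%:R.
Definition lcos (nu : probability R R) (t : R) : R := \int[nu]_y cos (t * y).
Definition lsin (nu : probability R R) (t : R) : R := \int[nu]_y sin (t * y).

Implicit Type nu : probability R R.

(** Measurability of a parameter integral, through Fubini. Here and in the next two lemmas [gauss]
    is an arbitrary probability on the parameter. *)
Lemma bmeas_lcdf nu : bmeas (lcdf nu).
Proof.
apply: (@bmeas_Rintegral1 _ _ _ _ _ gauss nu (fun z => ((z.2 <= z.1)%R)%:R)).
exact: bmeas_le.
Qed.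

Lemma bmeas_lcos nu : bmeas (lcos nu).
Proof.
apply: (@bmeas_Rintegral1 _ _ _ _ _ gauss nu (fun z => cos (z.1 * z.2))).
by apply: bmeas_cos; exact: measurable_funM.
Qed.

Lemma bmeas_lsin nu : bmeas (lsin nu).
Proof.
apply: (@bmeas_Rintegral1 _ _ _ _ _ gauss nu (fun z => sin (z.1 * z.2))).
by apply: bmeas_sin; exact: measurable_funM.
Qed.

Lemma lcdf01 nu x : 0 <= lcdf nu x <= 1.
Proof.
apply/andP; split; first by apply: Rintegral_ge0 => y _.
rewrite (le_trans (ler_norm _))//; apply: bmeas_Rintegral_norm.
  exact: (proj1 (bmeas_le _ _)).
by move=> y; case: (y <= x); rewrite ?normr1 ?normr0.
Qed.

Lemma lcdf_homo nu : {homo lcdf nu : x y / x <= y}.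
Proof.
move=> x y xy; apply: le_Rintegral => //; try exact/bmeas_integrable/bmeas_le.
move=> z _; rewrite ler_nat; case zx : (z <= x)%R => //.
by rewrite (le_trans zx xy).
Qed.

Section FirstMoment.
Variables (nu : probability R R) (e x : R).
Hypothesis nu1 : nu.-integrable setT (fun y => y%:E).
Hypothesis e0 : 0 < e.

Let sk (z : R * R) : R := snc ((x - z.2) / e) z.1.

Let ix : nu.-integrable setT (EFin \o (fun y => `|x - y| / e)).
Proof.
under eq_fun do rewrite mulrC.
apply: intRZl; apply: (@integrable_norm _ _ _ nu setT (fun y => x - y)).
by apply: intRB => //; exact/bmeas_integrable/bmeas_cst.
Qed.

(** The kernel is unbounded in [y], so [RFubini] does not cover it; [snc_le] dominates it by
    [|x - y| / e], integrable by the first moment of [nu]. *)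
Let isk : (gauss \x nu)%E.-integrable setT (EFin \o sk).
Proof.
have msk : measurable_fun setT (EFin \o sk).
  apply/measurable_EFinP.
  apply: measurable_snc => //; apply: measurable_funM => //.
  exact: measurable_funB.
apply/integrable21ltyP => //.
apply: le_lt_trans (integrable_lty measurableT ix).
apply: ge0_le_integral => //.
- by move=> y _; exact: integral_ge0.
- apply: (@measurable_fun_fubini_tonelli_G _ _ _ _ _ gauss (abse \o (EFin \o sk))).
    exact: measurableT_comp.
  by move=> z; exact: abse_ge0.
- exact: (measurable_int nu ix).
move=> y _; rewrite -[leRHS]mule1 -(@probability_setT _ _ _ (@gauss R)) -integral_cst//.
apply: ge0_le_integral => //.
- apply: (@measurableT_comp _ _ _ R _ _ abse setT (fun w => (snc ((x - y) / e) w)%:E)).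
    exact: abse_measurable.
  by apply/measurable_EFinP; exact: measurable_snc.
- by move=> w _; rewrite lee_fin (le_trans (snc_le _ _))// normrM (@ger0_norm _ e^-1)// invr_ge0 ltW.
Qed.

Let isk1 y : gauss.-integrable setT (EFin \o snc ((x - y) / e)).
Proof.
apply: bmeas_integrable; split; first exact: measurable_snc.
by exists `|(x - y) / e| => w; exact: snc_le.
Qed.

Let isk2 w : nu.-integrable setT (EFin \o (fun y => snc ((x - y) / e) w)).
Proof.
apply: (@le_intR _ _ _ nu (fun y => snc ((x - y) / e) w) _ _ _ ix) => [|y].
  by apply: measurable_snc => //; apply: measurable_funM => //; exact: measurable_funB.
by rewrite (le_trans (snc_le _ _))// normrM (@ger0_norm _ e^-1)// invr_ge0 ltW.
Qed.

Let isF : nu.-integrable setT (EFin \o (fun y => \int[gauss]_w snc ((x - y) / e) w)).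
Proof.
apply: (@le_intR _ _ _ nu _ _ _ _ ix) => [|y].
  apply: measurableT_comp => //; exact: (measurable_fubini_G isk).
apply: bmeas_Rintegral_norm => [|w]; first exact: measurable_snc.
by rewrite (le_trans (snc_le _ _))// normrM (@ger0_norm _ e^-1)// invr_ge0 ltW.
Qed.

Lemma integrable_snc_shift :
  gauss.-integrable setT (EFin \o (fun w => \int[nu]_y snc ((x - y) / e) w)).
Proof.
have := integrable_fubini_F isk; apply: eq_integrable => // w _.
by rewrite /fubini_F/= EFin_Rintegral//; exact: isk2.
Qed.

(** Gaussian averaging at scale [e] replaces the indicator of [y <= x] by [Phi ((x - y) / e)], which
    [Phi_snc] expands in frequencies. *)
Lemma lcdf_smooth :
  \int[gauss]_z lcdf nu (x - e * z) =
  Phi 0 + normal_peak (1 : R) * \int[gauss]_w \int[nu]_y snc ((x - y) / e) w.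
Proof.
have -> : \int[gauss]_w \int[nu]_y snc ((x - y) / e) w =
          \int[nu]_y \int[gauss]_w snc ((x - y) / e) w.
  apply: EFin_inj; rewrite -EFin_Rintegral; last exact: integrable_snc_shift.
  rewrite -[RHS]EFin_Rintegral; last exact: isF.
  have := Fubini isk; congr (_ = _); apply: eq_integral => y _.
    by rewrite EFin_Rintegral//; exact: isk2.
  by rewrite EFin_Rintegral//; exact: isk1.
transitivity (\int[nu]_y Phi ((x - y) / e)).
  rewrite /lcdf -(@RFubini _ _ _ _ _ nu gauss (fun z => ((z.1 <= x - e * z.2)%R)%:R)).
    apply: eq_Rintegral => y _; apply: eq_Rintegral => z _ /=.
    by rewrite ler_pdivlMr// lerBrDr addrC -lerBrDr mulrC.
  apply: bmeas_le => //; apply: measurable_funB => //; exact: measurable_funM.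
transitivity (\int[nu]_y (Phi 0 + normal_peak (1 : R) * \int[gauss]_w snc ((x - y) / e) w)).
  by apply: eq_Rintegral => y _; rewrite -Phi_snc [RHS]addrC subrK.
rewrite RintegralD//; [|exact/bmeas_integrable/bmeas_cst|exact: intRZl isF].
by rewrite Rintegral_cstT RintegralZl.
Qed.

(* Addition formula for the sine, at the frequency [w / e]. *)
Lemma snc_lcos_lsin w : w != 0 ->
  \int[nu]_y snc ((x - y) / e) w =
  (sin (w * x / e) * lcos nu (w / e) - cos (w * x / e) * lsin nu (w / e)) / w.
Proof.
move=> w0; have ic : nu.-integrable setT (EFin \o (fun y => cos (w / e * y))).
  by apply/bmeas_integrable/bmeas_cos; exact: measurable_funM.
have isn : nu.-integrable setT (EFin \o (fun y => sin (w / e * y))).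
  by apply/bmeas_integrable/bmeas_sin; exact: measurable_funM.
rewrite /lcos /lsin -!RintegralZl// -RintegralB//; [|exact: intRZl|exact: intRZl].
rewrite -RintegralZr//; last by apply: intRB; exact: intRZl.
apply: eq_Rintegral => y _; rewrite /snc (negbTE w0); congr (_ / _).
rewrite -sinB; congr sin; field.
by rewrite gt_eqF.
Qed.

End FirstMoment.

(** An Esseen inequality with Gaussian kernel: in the difference of the two formulas [lcdf_smooth]
    the term [Phi 0] cancels, and [snc_lcos_lsin] brings in the characteristic functions. The
    frequency integral is taken in the extended reals, so that its finiteness is part of the
    hypothesis. *)
Lemma smoothing nu1 nu2 (e om K : R) :
  nu1.-integrable setT (fun y => y%:E) -> nu2.-integrable setT (fun y => y%:E) ->
  0 < e -> 0 <= om -> (forall x, lcdf nu2 (x + 4 * e) - lcdf nu2 x <= om) ->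
  (\int[gauss]_w ((`|lcos nu1 (w / e) - lcos nu2 (w / e)|
     + `|lsin nu1 (w / e) - lsin nu2 (w / e)|) / `|w|)%:E <= K%:E)%E ->
  forall x, `|lcdf nu1 x - lcdf nu2 x| <= 2 * K + 2 * om.
Proof.
move=> i1 i2 e0 om0 Hom HK.
apply: (@desmoothing _ _ e) => //; try exact: lcdf_homo; try exact: lcdf01.
- by case: (bmeas_lcdf nu1).
- by case: (bmeas_lcdf nu2).
move=> x.
have bF nu : bmeas (fun z : R => lcdf nu (x - e * z)).
  apply: (@bmeas_comp _ _ R _ R (fun z => x - e * z)); last exact: bmeas_lcdf.
  by apply: measurable_funB => //; exact: measurable_funM.
rewrite RintegralB//; [|exact/bmeas_integrable|exact/bmeas_integrable].
rewrite !lcdf_smooth// opprD addrACA subrr add0r -mulrBr normrM (ger0_norm (ltW peak_gt0)).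
rewrite (le_trans (ler_piMl _ peak_le1))//.
have is1 := integrable_snc_shift x i1 e0; have is2 := integrable_snc_shift x i2 e0.
rewrite -RintegralB//.
rewrite -lee_fin; apply: le_trans HK.
rewrite EFin_normr_Rintegral//; last exact: intRB.
apply: (le_trans (le_abse_integral _ _ _)) => //.
  exact: (measurable_int gauss (intRB is1 is2)).
have mD nu : bmeas (fun w : R => lcos nu (w / e)) /\ bmeas (fun w : R => lsin nu (w / e)).
  by split; [apply: (@bmeas_comp _ _ R _ R (fun w => w / e)); [by apply: measurable_funM|exact: bmeas_lcos]
            |apply: (@bmeas_comp _ _ R _ R (fun w => w / e)); [by apply: measurable_funM|exact: bmeas_lsin]].
apply: ae_ge0_le_integral => //.
- by apply: measurableT_comp => //; exact: (measurable_int gauss (intRB is1 is2)).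
- apply/measurable_EFinP; apply: measurable_funM; last first.
    by apply: measurable_funV; exact: normr_measurable.
  have [c1 s1] := mD nu1; have [c2 s2] := mD nu2.
  by apply: (proj1 (bmeasD (bmeas_norm (bmeasB c1 c2)) (bmeas_norm (bmeasB s1 s2)))).
(* At [w = 0] the quotient has the default value [0] but [snc] does not vanish; this point is
   null. *)
exists [set 0%R]; split; [exact: measurable_set1|exact: gauss_set0|].
move=> w /= h; apply/eqP; apply: contra_notT h => w0 _.
rewrite lee_fin !snc_lcos_lsin// -mulrBl normrM normfV ler_wpM2r ?invr_ge0//.
have -> (a b c d s t : R) : s * a - t * b - (s * c - t * d) = s * (a - c) - t * (b - d) by ring.
by rewrite (le_trans (ler_normB _ _))// lerD// normrM ler_piMl// ?sin_max ?cos_max.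
Qed.

End Smoothing.

(** * Powers of a probability measure *)

Section ProductProbability.
Context {R : realType} {d1 d2} {T1 : measurableType d1} {T2 : measurableType d2}.
Variables (P1 : probability T1 R) (P2 : probability T2 R).

(** The product measure under a name of its own, to which the probability structure is attached. *)
Definition prodP : set (T1 * T2) -> \bar R := (P1 \x P2)%E.

HB.instance Definition _ := Measure.on prodP.

Let prodP_setT : prodP setT = 1%E.
Proof.
rewrite -setXTT [LHS](_ : _ = P1 setT * P2 setT)%E; last exact: product_measure1E.
by rewrite !probability_setT mul1e.
Qed.

HB.instance Definition _ := Measure_isProbability.Build _ _ _ prodP prodP_setT.

End ProductProbability.

Section PowerMeasure.
Context {R : realType}.
Variable mu : probability R R.

Definition consT n (z : R * n.-tuple R) : n.+1.-tuple R := [tuple of z.1 :: z.2].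

Lemma measurable_consT n : measurable_fun setT (@consT n).
Proof. by apply: measurable_cons. Qed.

HB.instance Definition _ n :=
  isMeasurableFun.Build _ _ _ _ (@consT n) (@measurable_consT n).

(** The law of [n] independent copies, by recursion so that integrals over tuples are peeled off one
    coordinate at a time. *)
Fixpoint pw (n : nat) : probability (n.-tuple R) R :=
  match n return probability (n.-tuple R) R with
  | 0 => \d_([tuple] : 0.-tuple R)
  | m.+1 => distribution (prodP mu (pw m)) (@consT m)
  end.

Lemma Rintegral_pwS n (f : n.+1.-tuple R -> R) : bmeas f ->
  \int[pw n.+1]_v f v = \int[mu]_x \int[pw n]_u f (consT (x, u)).
Proof.
move=> bf.
have bfc : bmeas (fun z => f (@consT n z)).
  by apply: (@bmeas_comp _ _ (n.+1.-tuple R) _ (R * n.-tuple R)%type (@consT n)).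
rewrite -(Rintegral_prod _ _ bfc).
congr fine; rewrite integral_distribution//.
  by apply/measurable_EFinP; case: bf.
exact: (bmeas_integrable (prodP mu (pw n)) bfc).
Qed.

Lemma Rintegral_pw0 (f : 0.-tuple R -> R) : \int[pw 0]_v f v = f [tuple].
Proof.
rewrite -[RHS](Rintegral_cstT (pw 0)); apply: eq_Rintegral => v _.
by rewrite (tuple0 v).
Qed.

Lemma integrable_pwS n (f : n.+1.-tuple R -> R) : measurable_fun setT f ->
  (\int[mu]_x \int[pw n]_u (`|f (consT (x, u))|%:E) < +oo)%E ->
  (pw n.+1).-integrable setT (EFin \o f).
Proof.
move=> mf fi; apply/integrableP; split; first exact/measurable_EFinP.
rewrite ge0_integral_distribution//; last first.
  by apply: measurableT_comp => //; exact/measurable_EFinP.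
rewrite [X in (X < _)%E](_ : _ = \int[mu]_x \int[pw n]_u (`|f (consT (x, u))|%:E))%E//.
apply: (@fubini_tonelli1 _ _ _ _ _ mu (pw n) (fun z => `|f (consT z)|%:E)) => //.
apply/measurable_EFinP; apply: measurableT_comp => //.
by apply: (@measurableT_comp _ _ _ (R * n.-tuple R)%type _ R f).
Qed.

Lemma integral_pwS n (f : n.+1.-tuple R -> R) :
  (pw n.+1).-integrable setT (EFin \o f) ->
  (\int[pw n.+1]_v (f v)%:E = \int[mu]_x \int[pw n]_u (f (consT (x, u)))%:E)%E.
Proof.
move=> fi; have mf := measurable_int (pw n.+1) fi.
have mfc : measurable_fun setT (fun z : R * n.-tuple R => (f (consT z))%:E).
  exact: (@measurableT_comp _ _ _ (R * n.-tuple R)%type _ _ (EFin \o f)).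
have ic : (mu \x pw n)%E.-integrable setT (fun z => (f (consT z))%:E).
  apply/integrableP; split => //.
  have /integrableP[_] := fi.
  rewrite ge0_integral_distribution//.
  exact: measurableT_comp.
by rewrite integral_distribution// [RHS](integral12_prod_meas1 ic).
Qed.

Definition box n (A : 'I_n -> set R) : set (n.-tuple R) :=
  [set v | forall i, A i (tnth v i)].

Lemma measurable_box n (A : 'I_n -> set R) :
  (forall i, measurable (A i)) -> measurable (box A).
Proof.
move=> mA; have -> : box A = \bigcap_(i in [set: 'I_n]) ((@tnth n R)^~ i @^-1` A i).
  by apply/seteqP; split => [v h i _|v h i]; [exact: h|exact: (h i I)].
apply: fin_bigcap_measurable => // i _; rewrite -[X in measurable X]setTI.
exact: measurable_tnth.
Qed.

Lemma tnth_consT0 n x (u : n.-tuple R) : tnth (consT (x, u)) ord0 = x.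
Proof. by []. Qed.

Lemma tnth_consTS n x (u : n.-tuple R) i : tnth (consT (x, u)) (lift ord0 i) = tnth u i.
Proof. exact: tnthS. Qed.

Lemma pw_box n (A : 'I_n -> set R) : (forall i, measurable (A i)) ->
  pw n (box A) = (\prod_(i < n) mu (A i))%E.
Proof.
elim: n A => [|n IH] A mA.
  rewrite big_ord0 [LHS]/= diracE mem_set//.
  by case.
rewrite big_ord_recl -IH//.
rewrite [LHS](_ : _ = (mu \x pw n)%E (A ord0 `*` box (fun i => A (lift ord0 i)))).
  by rewrite product_measure1E//; exact: measurable_box.
congr ((mu \x pw n)%E); apply/seteqP; split => -[x u]/=.
  by move=> h; split=> [|i]; [exact: (h ord0)|have := h (lift ord0 i); rewrite tnth_consTS].
move=> [h0 hS] i; case: (unliftP ord0 i) => [j ->|->]; last exact: h0.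
by rewrite tnth_consTS; exact: hS.
Qed.

(** Boxes are stable under intersection and generate the sigma-algebra of tuples, a coordinate
    preimage being a box whose other sides are the whole line. *)
Lemma pw_unique n (m : probability (n.-tuple R) R) :
  (forall A : 'I_n -> set R, (forall i, measurable (A i)) ->
    m (box A) = (\prod_(i < n) mu (A i))%E) ->
  forall B, measurable B -> m B = pw n B.
Proof.
move=> mbox B mB.
apply: (measure_unique [set C | exists2 A : 'I_n -> set R, (forall i, measurable (A i)) & C = box A] (fun=> setT)) => //.
- apply/seteqP; split.
    rewrite [X in X `<=` _](_ : _ = g_sigma_preimage (fun i (x : n.-tuple R) => tnth x i))//.
    apply: smallest_sub; first exact: smallest_sigma_algebra.
    apply: subset_trans; last exact: sub_sigma_algebra.
    rewrite -bigcup_seq/=; apply: bigcup_sub => i _ C [A mA <-]; rewrite setTI.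
    exists (fun j => if j == i then A else setT).
      by move=> j; case: ifP.
    apply/seteqP; split => v/=.
      by move=> Av j; case: eqP => [->|].
    by move=> /(_ i); rewrite eqxx.
  apply: smallest_sub; first exact: sigma_algebra_measurable.
  by move=> _ [A mA ->]; exact: measurable_box.
- move=> _ _ [A mA ->] [A' mA' ->]; exists (fun i => A i `&` A' i).
    by move=> i; exact: measurableI.
  by apply/seteqP; split => [v [h h'] i|v h]; [split|split => i; have [] := h i].
- move=> _; exists (fun=> setT) => //.
  by apply/seteqP; split.
- by apply/seteqP; split => // v _; exists 0%N.
- by move=> _ [A mA ->]; exact: etrans (mbox A mA) (esym (pw_box mA)).
- by move=> _; rewrite (le_lt_trans (probability_le1 _ _))// ltry.
Qed.

End PowerMeasure.

Section LawOfX.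
Context {R : realType}.

(** Independence, taken for the full index set, is the product formula on boxes. The sample space
    can thus be replaced by [pw mu n]. *)
Lemma iid_law (mu : probability R R) d (T : measurableType d) (P : probability T R) n
    (X : {RV P >-> n.-tuple R}) :
  iid_components P X mu ->
  forall B, measurable B -> P (X @^-1` B) = pw mu n B.
Proof.
move=> [indep marg] B mB; apply: (@pw_unique _ mu n (distribution P X)) => // A mA.
rewrite [LHS](_ : _ = P (\bigcap_(i in [set` [set: 'I_n]%SET]) (component X i @^-1` A i))).
  rewrite indep// big_mkcond/=; apply: eq_bigr => i _.
  by rewrite inE marg.
congr (P _); apply/seteqP; split => [w h i _|w h i]; first exact: h.
by apply: h; rewrite /= inE.
Qed.

End LawOfX.

(** * Vectors *)

Section Vectors.
Context {R : realType}.
Implicit Types (n : nat).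

Definition scalev n (c : R) (u : n.-tuple R) : n.-tuple R := [tuple c * tnth u i | i < n].
Definition subv n (u v : n.-tuple R) : n.-tuple R := [tuple tnth u i - tnth v i | i < n].

Lemma dotC n (u v : n.-tuple R) : dot u v = dot v u.
Proof. by apply: eq_bigr => i _; rewrite mulrC. Qed.

Lemma dot_scalel n c (u v : n.-tuple R) : dot (scalev c u) v = c * dot u v.
Proof. by rewrite /dot mulr_sumr; apply: eq_bigr => i _; rewrite tnth_mktuple mulrA. Qed.

Lemma dot_scaler n c (u v : n.-tuple R) : dot u (scalev c v) = c * dot u v.
Proof. by rewrite dotC dot_scalel dotC. Qed.

Lemma dot_subl n (u v w : n.-tuple R) : dot (subv u v) w = dot u w - dot v w.
Proof.
rewrite /dot -sumrB; apply: eq_bigr => i _; rewrite tnth_mktuple; ring.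
Qed.

Lemma dot_consT n a b (u v : n.-tuple R) :
  dot (consT (a, u)) (consT (b, v)) = a * b + dot u v.
Proof.
rewrite /dot big_ord_recl !tnth_consT0; congr (_ + _).
by apply: eq_bigr => i _; rewrite !tnth_consTS.
Qed.

Lemma dot_ge0 n (u : n.-tuple R) : 0 <= dot u u.
Proof. by apply: sumr_ge0 => i _; rewrite -expr2 sqr_ge0. Qed.

Lemma enorm_ge0 n (u : n.-tuple R) : 0 <= enorm u. Proof. exact: sqrtr_ge0. Qed.

Lemma enorm_sqr n (u : n.-tuple R) : enorm u ^+ 2 = dot u u.
Proof. by rewrite sqr_sqrtr// dot_ge0. Qed.

Lemma measurable_dot {d} {T : measurableType d} n (f g : T -> n.-tuple R) :
  measurable_fun setT f -> measurable_fun setT g ->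
  measurable_fun setT (fun x => dot (f x) (g x)).
Proof.
move=> mf mg; apply: measurable_sum => i; apply: measurable_funM.
  exact: (measurableT_comp (measurable_tnth i)).
exact: (measurableT_comp (measurable_tnth i)).
Qed.

Lemma measurable_sqrt {d} {T : measurableType d} (f : T -> R) :
  measurable_fun setT f -> measurable_fun setT (fun x => Num.sqrt (f x)).
Proof.
move=> mf; apply: measurableT_comp => //.
by apply: continuous_measurable_fun; exact: sqrt_continuous.
Qed.

Lemma measurable_enorm {d} {T : measurableType d} n (f : T -> n.-tuple R) :
  measurable_fun setT f -> measurable_fun setT (fun x => enorm (f x)).
Proof. by move=> mf; apply: measurable_sqrt; exact: measurable_dot. Qed.

Lemma bmeas_prod {d} {T : measurableType d} n (f : 'I_n -> T -> R) :
  (forall i, bmeas (f i)) -> bmeas (fun x => \prod_(i < n) f i x).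
Proof.
elim: n f => [|n IH] f bf.
  by under eq_fun do rewrite big_ord0; exact: bmeas_cst.
by under eq_fun do rewrite big_ord_recl; apply: bmeasM => //; exact: IH.
Qed.

(** Tensorization, by induction on the coordinates: the source of the [n]-th powers of [alph] and
    [beta]. *)
Lemma pw_prod (mu : probability R R) (k : R * R -> R) n : bmeas k ->
  \int[pw mu n]_x \int[pw mu n]_y \prod_(i < n) k (tnth x i, tnth y i) =
  (\int[mu]_a \int[mu]_b k (a, b)) ^+ n.
Proof.
move=> bk; elim: n => [|n IH].
  by rewrite !Rintegral_pw0 big_ord0 expr0.
have bp m : bmeas (fun z : m.-tuple R * m.-tuple R => \prod_(i < m) k (tnth z.1 i, tnth z.2 i)).
  apply: bmeas_prod => i.
  apply: (@bmeas_comp _ _ (R * R)%type _ (m.-tuple R * m.-tuple R)%type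
    (fun z => (tnth z.1 i, tnth z.2 i))) => //.
  apply: measurable_fun_pair.
    exact: (measurableT_comp (measurable_tnth i)).
  exact: (measurableT_comp (measurable_tnth i)).
have bI m := bmeas_Rintegral1 (pw mu m) (pw mu m) (bp m).
rewrite Rintegral_pwS//=; last exact: bI.
transitivity (\int[mu]_a \int[pw mu n]_u ((\int[mu]_b k (a, b)) *
    (\int[pw mu n]_y \prod_(i < n) k (tnth u i, tnth y i)))).
  apply: eq_Rintegral => a _; apply: eq_Rintegral => u _.
  rewrite Rintegral_pwS; last exact: (bmeas_pair1 _ (bp n.+1)).
  transitivity (\int[mu]_b \int[pw mu n]_y (k (a, b) * \prod_(i < n) k (tnth u i, tnth y i))).
    apply: eq_Rintegral => b _; apply: eq_Rintegral => y _.
    rewrite big_ord_recl !tnth_consT0; congr (_ * _); apply: eq_bigr => i _.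
    by rewrite !tnth_consTS.
  transitivity (\int[mu]_b (k (a, b) * \int[pw mu n]_y \prod_(i < n) k (tnth u i, tnth y i))).
    apply: eq_Rintegral => b _; rewrite RintegralZl//.
    exact/bmeas_integrable/(bmeas_pair1 _ (bp n)).
  rewrite RintegralZr//; exact/bmeas_integrable/bmeas_pair1.
transitivity (\int[mu]_a ((\int[mu]_b k (a, b)) * (\int[mu]_a \int[mu]_b k (a, b)) ^+ n)).
  apply: eq_Rintegral => a _; rewrite RintegralZl ?IH//.
  exact/bmeas_integrable/bI.
rewrite RintegralZr// ?exprS//.
exact/bmeas_integrable/(bmeas_Rintegral1 mu mu bk).
Qed.

(** In the induction the contribution of the first coordinate is moved into the phase [a]. *)
Lemma gauss_vec_cos n (a : R) (v : n.-tuple R) :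
  \int[pw gauss n]_z cos (a + dot v z) = cos a * expR (- (dot v v / 2)).
Proof.
elim: n a v => [|n IH] a v.
  by rewrite Rintegral_pw0 /dot !big_ord0 mul0r addr0 oppr0 expR0 mulr1.
have -> : v = consT (thead v, [tuple of behead v]) by rewrite /consT/= -tuple_eta.
move: (thead v) [tuple of behead v] => t u {v}.
rewrite Rintegral_pwS; last first.
  apply: bmeas_cos; apply: measurable_funD => //; exact: measurable_dot.
transitivity (\int[gauss]_x (expR (- (dot u u / 2)) * cos (a + t * x))).
  by apply: eq_Rintegral => x _; under eq_Rintegral do rewrite dot_consT addrA; rewrite IH mulrC.
rewrite RintegralZl//; last first.
  by apply/bmeas_integrable/bmeas_cos; apply: measurable_funD => //; exact: measurable_funM.
by rewrite gauss_cos dot_consT mulrCA -expRD -expr2; congr (_ * expR _); lra.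
Qed.

End Vectors.

(** * Rotation invariance *)

Section GaussNorm.
Context {R : realType}.

(** The variance of the square of a standard normal variable; it enters the final constant as a
    symbol. *)
Definition gvar : R := \int[gauss]_x ((x ^+ 2 - 1) ^+ 2).

Let S n (z : n.-tuple R) : R := dot z z - n%:R.

Let mS n : measurable_fun setT (@S n).
Proof. by apply: measurable_funB => //; exact: measurable_dot. Qed.

Let SS n x (u : n.-tuple R) : S (consT (x, u)) = (x ^+ 2 - 1) + S u.
Proof. by rewrite /S dot_consT -natr1 -expr2; ring. Qed.

(** [S z] is a sum of [n] independent centred terms. The four claims go through one induction
    because the cross term of the square vanishes by the mean of the shorter sum. *)
Lemma gauss_vec_var n :
  [/\ (pw gauss n).-integrable setT (EFin \o @S n),
      (pw gauss n).-integrable setT (EFin \o (fun z => S z ^+ 2)),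
      \int[pw gauss n]_z S z = 0 &
      \int[pw gauss n]_z (S z ^+ 2) = n%:R * gvar].
Proof.
elim: n => [|n [i1 i2 e1 e2]].
  have S0 (z : 0.-tuple R) : S z = 0 by rewrite /S /dot big_ord0 subrr.
  have -> : @S 0 = fun=> 0 by apply/funext => z; exact: S0.
  split; [exact/bmeas_integrable/bmeas_cst| |exact: Rintegral_cstT|].
    by rewrite expr0n; exact/bmeas_integrable/bmeas_cst.
  by rewrite expr0n Rintegral_cstT mul0r.
have q1 := @gauss_integrable_var R; have q2 := @gauss_integrable_var2 R.
have ic (c : R) : (pw gauss n).-integrable setT (EFin \o (fun=> c)) by exact/bmeas_integrable/bmeas_cst.
have gc (c : R) : gauss.-integrable setT (EFin \o (fun=> c)) by exact/bmeas_integrable/bmeas_cst.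
have in1 x : (pw gauss n).-integrable setT (EFin \o (fun u => S (consT (x, u)))).
  rewrite (_ : (fun u => _) = fun u => (x ^+ 2 - 1) + S u); first exact: intRD.
  by apply/funext => u; exact: SS.
have E2 x u : S (@consT _ n (x, u)) ^+ 2 = (x ^+ 2 - 1) ^+ 2 + (2 * (x ^+ 2 - 1) * S u + S u ^+ 2).
  by rewrite SS; ring.
have in2 x : (pw gauss n).-integrable setT (EFin \o (fun u => S (consT (x, u)) ^+ 2)).
  rewrite (_ : (fun u => _) = fun u => (x ^+ 2 - 1) ^+ 2 + (2 * (x ^+ 2 - 1) * S u + S u ^+ 2)).
    by apply: intRD => //; apply: intRD => //; exact: intRZl.
  by apply/funext => u; exact: E2.
have int2 x : \int[pw gauss n]_u (S (consT (x, u)) ^+ 2) = (x ^+ 2 - 1) ^+ 2 + n%:R * gvar.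
  under eq_Rintegral do rewrite E2.
  rewrite RintegralD//; last by apply: intRD => //; exact: intRZl.
  rewrite Rintegral_cstT RintegralD//; last exact: intRZl.
  by rewrite RintegralZl// e1 mulr0 add0r e2.
have I2 : (\int[gauss]_x \int[pw gauss n]_u (S (consT (x, u)) ^+ 2)%:E = (n.+1%:R * gvar)%:E)%E.
  transitivity (\int[@gauss R]_x ((x ^+ 2 - 1) ^+ 2 + n%:R * gvar)%:E)%E.
    by apply: eq_integral => x _; rewrite EFin_Rintegral ?int2//; exact: in2.
  rewrite EFin_Rintegral; last exact: intRD.
  by rewrite RintegralD// Rintegral_cstT -natr1 -/gvar; congr EFin; ring.
have J2 : (pw gauss n.+1).-integrable setT (EFin \o (fun z => S z ^+ 2)).
  apply: integrable_pwS; first by apply: measurable_funX; exact: mS.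
  under eq_integral do under eq_integral do rewrite ger0_norm ?sqr_ge0//.
  by rewrite I2 ltry.
have J1 : (pw gauss n.+1).-integrable setT (EFin \o @S n.+1).
  apply: (@le_intR _ _ _ (pw gauss n.+1) _ (fun z => 1 + S z ^+ 2)) => [||].
  - exact: mS.
  - move=> z; have := sqr_ge0 (`|S z| - 1); rewrite sqrrB1 real_normK ?num_real// -mulr_natr.
    by have := sqr_ge0 (S z); lra.
  - by apply: intRD => //; exact/bmeas_integrable/bmeas_cst.
split => //.
- apply: EFin_inj; rewrite -(EFin_Rintegral J1) (integral_pwS J1).
  transitivity (\int[@gauss R]_x (x ^+ 2 - 1)%:E)%E; last first.
    by rewrite (EFin_Rintegral q1) gauss_var0.
  apply: eq_integral => x _; rewrite (EFin_Rintegral (in1 x)).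
  by under eq_Rintegral do rewrite SS; rewrite RintegralD// Rintegral_cstT e1 addr0.
- by apply: EFin_inj; rewrite -(EFin_Rintegral J2) (integral_pwS J2) I2.
Qed.

Lemma gvar_ge0 : 0 <= gvar. Proof. by apply: Rintegral_ge0 => x _; rewrite sqr_ge0. Qed.

(** Serves both as the random factor [l], for Gaussian [z], and as the radius [r], for a value of
    [X]. *)
Definition lam n (z : n.-tuple R) : R := enorm z / Num.sqrt n%:R.

Lemma lam_ge0 n (z : n.-tuple R) : 0 <= lam z.
Proof. by rewrite divr_ge0// ?enorm_ge0// sqrtr_ge0. Qed.

Lemma lam_sqr n (z : n.-tuple R) : lam z ^+ 2 = dot z z / n%:R.
Proof. by rewrite /lam expr_div_n enorm_sqr sqr_sqrtr// ler0n. Qed.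

Lemma measurable_lam n : measurable_fun setT (@lam n).
Proof. by apply: measurable_funM => //; exact: measurable_enorm. Qed.

(* [|l - 1| <= |l ^ 2 - 1|] for [0 <= l], then AM-GM. *)
Lemma lam_dist n : (0 < n)%N ->
  (\int[pw gauss n]_z (`|lam z - 1|)%:E <= ((1 + gvar) / Num.sqrt n%:R)%:E)%E.
Proof.
move=> n0; have [_ i2 _ e2] := gauss_vec_var n.
have nr0 : 0 < n%:R :> R by rewrite ltr0n.
set sn := Num.sqrt n%:R; have sn0 : 0 < sn by rewrite sqrtr_gt0.
have sn2 : sn * sn = n%:R by rewrite -expr2 sqr_sqrtr// ltW.
(* Weights chosen so that, [S z ^+ 2] having mean [n gvar], both terms are of order [1 / sn]. *)
have pt (z : n.-tuple R) : `|lam z - 1| <= sn^-1 + (n%:R * sn)^-1 * S z ^+ 2.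
  have h1 : `|lam z - 1| <= `|S z| / n%:R.
    have -> : `|S z| / n%:R = `|lam z ^+ 2 - 1|.
      rewrite lam_sqr (_ : dot z z / n%:R - 1 = S z / n%:R); last by rewrite /S; field; rewrite gt_eqF.
      by rewrite normrM normfV (gtr0_norm nr0).
    rewrite (_ : lam z ^+ 2 - 1 = (lam z - 1) * (lam z + 1)); last by ring.
    rewrite normrM ler_peMr// (ger0_norm (addr_ge0 (lam_ge0 z) ler01)).
    by have := lam_ge0 z; lra.
  rewrite (le_trans h1)// ler_pdivrMr//.
  have -> : (sn^-1 + (n%:R * sn)^-1 * S z ^+ 2) * n%:R = sn + S z ^+ 2 / sn.
    by rewrite -sn2; field; rewrite gt_eqF.
  rewrite -(real_normK (num_real (S z))).
  rewrite -(ler_pM2r sn0) mulrDl divfK ?gt_eqF//.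
  have := sqr_ge0 (sn - `|S z|); have := sqr_ge0 (sn); have := sqr_ge0 `|S z|.
  rewrite !expr2; nra.
have ib : (pw gauss n).-integrable setT (EFin \o (fun z => sn^-1 + (n%:R * sn)^-1 * S z ^+ 2)).
  by apply: intRD; [exact/bmeas_integrable/bmeas_cst|exact: intRZl].
have mlam : measurable_fun setT (fun z => `|@lam n z - 1|).
  by apply: measurableT_comp => //; apply: measurable_funB => //; exact: measurable_lam.
have il : (pw gauss n).-integrable setT (EFin \o (fun z => `|lam z - 1|)).
  by apply: (le_intR mlam _ ib) => z; rewrite normr_id.
rewrite EFin_Rintegral// lee_fin (le_trans (le_Rintegral _ il ib _))//.
rewrite RintegralD//; [|exact/bmeas_integrable/bmeas_cst|exact: intRZl].
rewrite Rintegral_cstT RintegralZl// e2.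
rewrite le_eqVlt; apply/orP; left; apply/eqP; field.
by rewrite !gt_eqF.
Qed.

End GaussNorm.

(** * Reflections and the uniform measure on the sphere *)

Section Rotation.
Context {R : realType}.

(** The reflection along [w = u - u'] exchanges two vectors of equal norm, and its matrix is
    symmetric. The identity serves when [w = 0]. *)
Lemma householder n (u u' : n.-tuple R) : dot u u = dot u' u' ->
  exists2 Q : 'M[R]_n, Q *m Q^T = 1%:M &
    forall v : n.-tuple R, dot u (apply_mx Q v) = dot u' v.
Proof.
move=> uu'; pose w := subv u u'.
have [w0|w0] := eqVneq (dot w w) 0.
  exists 1%:M; first by rewrite trmx1 mulmx1.
  have wi i : tnth u i = tnth u' i.
    move/eqP: w0; rewrite psumr_eq0; last by move=> j _; rewrite -expr2 sqr_ge0.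
    by move=> /allP/(_ i (mem_index_enum _)); rewrite mulf_eq0 orbb tnth_mktuple subr_eq0 => /eqP.
  move=> v; rewrite /dot; apply: eq_bigr => i _; rewrite wi; congr (_ * _).
  rewrite tnth_mktuple (bigD1 i)//= mxE eqxx mul1r big1 ?addr0// => j ji.
  by rewrite mxE eq_sym (negbTE ji) mul0r.
pose W : 'cV[R]_n := \col_i tnth w i.
pose k := 2 / dot w w.
have WW : W^T *m W = (dot w w)%:M.
  apply/matrixP => i j; rewrite !ord1 mxE [RHS]mxE eqxx mulr1n.
  by apply: eq_bigr => l _; rewrite !mxE.
pose Q : 'M[R]_n := 1%:M - k *: (W *m W^T).
have QT : Q^T = Q by rewrite /Q linearB/= linearZ/= trmx1 trmx_mul trmxK.
have MM : (W *m W^T) *m (W *m W^T) = dot w w *: (W *m W^T).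
  by rewrite mulmxA -(mulmxA W) WW mul_mx_scalar -scalemxAl.
(* The equality of norms enters here; it makes [k <u, w> = 1]. *)
have duw : dot w w = 2 * dot u w.
  have xw x : dot x w = dot x u - dot x u' by rewrite dotC dot_subl !(dotC x).
  by rewrite [LHS]dot_subl !xw (dotC u' u) -uu'; ring.
exists Q.
  rewrite QT /Q mulmxBl mul1mx mulmxBr mulmx1 -scalemxAl -scalemxAr MM !scalerA.
  rewrite (_ : k * k * dot w w = k + k); last by rewrite /k; field.
  by rewrite scalerDl opprD opprK addKr subrK.
move=> v.
have Qv i : tnth (apply_mx Q v) i = tnth v i - k * dot w v * tnth w i.
  rewrite tnth_mktuple; under eq_bigr => j _.
    rewrite !mxE big_ord1 !mxE mulrBl.
    rewrite (_ : k * (tnth w i * tnth w j) * tnth v j = k * tnth w i * (tnth w j * tnth v j)); last by ring.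
    over.
  rewrite sumrB -mulr_sumr -/(dot w v); congr (_ - _); last by ring.
  rewrite (bigD1 i)//= eqxx mul1r big1 ?addr0// => j ji.
  by rewrite eq_sym (negbTE ji) mul0r.
rewrite /dot; under eq_bigr do rewrite Qv mulrBr mulrCA.
rewrite sumrB -mulr_sumr -!/(dot _ _).
rewrite (_ : k * dot w v * dot u w = dot w v); last first.
  by move: w0; rewrite /k duw => w0; field; move: w0; rewrite mulf_eq0 negb_or => /andP[].
by rewrite /w dot_subl; ring.
Qed.

Lemma measurable_apply_mx n (Q : 'M[R]_n) : measurable_fun setT (apply_mx Q).
Proof.
apply/measurable_fun_tnthP => i.
rewrite (_ : _ \o _ = fun x => \sum_(j < n) Q i j * tnth x j).
  by apply: measurable_sum => j; apply: measurable_funM => //; exact: measurable_tnth.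
by apply/funext => x; rewrite /= tnth_mktuple.
Qed.

HB.instance Definition _ n (Q : 'M[R]_n) :=
  isMeasurableFun.Build _ _ _ _ (apply_mx Q) (measurable_apply_mx Q).

Lemma sphere_cos_rot n (sigma : probability (n.-tuple R) R) (u u' : n.-tuple R) :
  uniform_on_sphere sigma -> dot u u = dot u' u' ->
  \int[sigma]_th cos (dot u th) = \int[sigma]_th cos (dot u' th).
Proof.
move=> [_ inv] uu'; have [Q QQ Qu] := householder uu'.
have bc (v : n.-tuple R) : bmeas (fun th : n.-tuple R => cos (dot v th)).
  by apply: bmeas_cos; exact: measurable_dot.
transitivity (\int[distribution sigma (apply_mx Q)]_th cos (dot u th)).
  by congr fine; apply: eq_measure_integral => A mA _; exact: (esym (inv Q A QQ mA)).
congr fine; rewrite integral_distribution//.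
- by apply: eq_integral => th _; rewrite /= Qu.
- by apply/measurable_EFinP; case: (bc u).
- apply: (bmeas_integrable sigma (f := fun th => cos (dot u (apply_mx Q th)))).
  apply: (@bmeas_comp _ _ (n.-tuple R) _ (n.-tuple R) (apply_mx Q)
    (fun th => cos (dot u th))); first exact: measurable_apply_mx.
  exact: bc.
Qed.

End Rotation.

(** * Averaging over random multiples of points of the sphere *)

Section SphereGauss.
Context {R : realType} {n : nat}.
Variable sigma : probability (n.-tuple R) R.
Hypothesis sigmaU : uniform_on_sphere sigma.
Hypothesis n0 : (0 < n)%N.

Lemma measurable_sphere : measurable (sphere R n).
Proof.
rewrite (_ : sphere R n = (fun x => enorm x) @^-1` [set 1%R]); last by apply/seteqP; split.
rewrite -[X in measurable X]setTI; exact: (measurable_enorm (@measurable_id _ _ setT)).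
Qed.

Lemma sphere_null : sigma (~` sphere R n) = 0%E.
Proof.
rewrite probability_setC; last exact: measurable_sphere.
by have [-> _] := sigmaU; rewrite subee.
Qed.

Lemma sphere_int_cst (f : n.-tuple R -> R) (c : R) : bmeas f ->
  (forall th, sphere R n th -> f th = c) -> \int[sigma]_th f th = c.
Proof.
move=> bf fc; rewrite -[RHS](Rintegral_cstT sigma); congr fine.
apply: ae_eq_integral => //.
  by apply/measurable_EFinP; case: bf.
exists (~` sphere R n); split.
- by apply: measurableC; exact: measurable_sphere.
- exact: sphere_null.
- by move=> th /=; apply: contra_not => sth _; rewrite fc.
Qed.

(* Law of [p]: [p.1] on the sphere, [p.2] an independent Gaussian vector, of
   which only the norm is used. *)
Let W : probability (n.-tuple R * n.-tuple R)%type R := prodP sigma (pw gauss n).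
Let h (t : R) (x : n.-tuple R) (p : n.-tuple R * n.-tuple R) : R :=
  t * lam p.2 * dot x p.1.

Let mh2 t : measurable_fun setT (fun q : (n.-tuple R * n.-tuple R) * n.-tuple R => h t q.2 q.1).
Proof.
apply: measurable_funM.
  apply: measurable_funM => //; apply: measurableT_comp; first exact: measurable_lam.
  exact: (measurableT_comp measurable_snd).
apply: measurable_dot => //.
exact: (measurableT_comp measurable_fst).
Qed.

Let mh t x : measurable_fun setT (h t x).
Proof.
apply: (@measurableT_comp _ _ _ _ ((n.-tuple R * n.-tuple R) * n.-tuple R)%type _ _ _ (fun p => (p, x)) (mh2 t)).
exact: measurable_fun_pair.
Qed.

(* Both vectors [|z| u] and [|u| z] have the same norm, so that averaging over
   the sphere turns [|z| <u, th>] into [|u| <z, th>]. *)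
Lemma sphere_gauss_cos (t : R) (u : n.-tuple R) :
  \int[W]_p cos (h t u p) = expR (- (t ^+ 2 * dot u u / (2 * n%:R))).
Proof.
have nr0 : 0 < n%:R :> R by rewrite ltr0n.
have bc := bmeas_cos (mh t u).
rewrite [LHS](_ : _ = \int[sigma]_th \int[pw gauss n]_z cos (h t u (th, z))); last first.
  exact: Rintegral_prod.
rewrite (RFubini sigma (pw gauss n) bc).
pose c := t / Num.sqrt n%:R * enorm u.
have bc2 : bmeas (fun q : n.-tuple R * n.-tuple R => cos (dot (scalev c q.2) q.1)).
  apply: bmeas_cos; rewrite (_ : (fun q => _) = fun q : n.-tuple R * n.-tuple R => c * dot q.2 q.1).
    by apply: measurable_funM => //; exact: measurable_dot.
  by apply/funext => q; rewrite dot_scalel.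
transitivity (\int[pw gauss n]_z \int[sigma]_th cos (dot (scalev c z) th)).
  apply: eq_Rintegral => z _.
  transitivity (\int[sigma]_th cos (dot (scalev (t * lam z) u) th)).
    by apply: eq_Rintegral => th _; rewrite /h/= dot_scalel.
  apply: sphere_cos_rot => //; rewrite !dot_scalel !dot_scaler -!enorm_sqr /c /lam.
  by ring.
rewrite -(RFubini _ _ bc2)/=.
apply: sphere_int_cst; first exact: (bmeas_Rintegral1 sigma (pw gauss n) bc2).
move=> th; rewrite /sphere/= => th1.
transitivity (\int[pw gauss n]_z cos (0 + dot (scalev c th) z)).
  by apply: eq_Rintegral => z _; rewrite !dot_scalel dotC add0r.
rewrite gauss_vec_cos cos0 mul1r dot_scalel dot_scaler -!enorm_sqr th1 /c; congr (expR (- _)).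
rewrite -{3}(@sqr_sqrtr _ n%:R) ?ler0n//; field.
by rewrite gt_eqF// sqrtr_gt0.
Qed.

Variable Q : probability (n.-tuple R) R.

(** [Cp] and [Sp] are the real and imaginary parts of the characteristic function of [<X, l theta>]
    for fixed [p]. The mean of [Cp] over [p] is [gch], which is also the characteristic function of
    [r Z]. *)
Definition Cp (t : R) (p : n.-tuple R * n.-tuple R) := \int[Q]_x cos (t * lam p.2 * dot x p.1).
Definition Sp (t : R) (p : n.-tuple R * n.-tuple R) := \int[Q]_x sin (t * lam p.2 * dot x p.1).
Definition gch (t : R) := \int[Q]_x expR (- (t ^+ 2 * dot x x / (2 * n%:R))).

(** The squared modulus [Cp^2 + Sp^2] is the mean of [cos (h (x - y))] over independent [x] and [y];
    Fubini and [sphere_gauss_cos] evaluate its average over [W]. The cross term is known because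
    [Cp t] has mean [gch t]. *)
Lemma sphere_variance (t : R) :
  \int[W]_p ((Cp t p - gch t) ^+ 2 + Sp t p ^+ 2) =
  \int[Q]_x \int[Q]_y expR (- (t ^+ 2 * dot (subv x y) (subv x y) / (2 * n%:R))) - gch t ^+ 2.
Proof.
have bcos : bmeas (fun q : (n.-tuple R * n.-tuple R) * n.-tuple R => cos (h t q.2 q.1)).
  exact: bmeas_cos.
have bsin : bmeas (fun q : (n.-tuple R * n.-tuple R) * n.-tuple R => sin (h t q.2 q.1)).
  exact: bmeas_sin.
have bC : bmeas (Cp t) := bmeas_Rintegral1 W Q bcos.
have bS : bmeas (Sp t) := bmeas_Rintegral1 W Q bsin.
have EC : \int[W]_p Cp t p = gch t.
  transitivity (\int[Q]_x \int[W]_p cos (h t x p)); first exact: RFubini bcos.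
  by apply: eq_Rintegral => x _; exact: sphere_gauss_cos.
have bk : bmeas (fun q : (n.-tuple R * n.-tuple R) * (n.-tuple R * n.-tuple R) =>
    cos (h t (subv q.2.1 q.2.2) q.1)).
  rewrite (_ : (fun q => _) = fun q => cos (h t q.2.1 q.1 - h t q.2.2 q.1)).
    apply: bmeas_cos; apply: measurable_funB.
      apply: (@measurableT_comp _ _ _ _ ((n.-tuple R * n.-tuple R) * n.-tuple R)%type _ _ _ (fun q => (q.1, q.2.1)) (mh2 t)).
      by apply: measurable_fun_pair => //; exact: (measurableT_comp measurable_fst).
    apply: (@measurableT_comp _ _ _ _ ((n.-tuple R * n.-tuple R) * n.-tuple R)%type _ _ _ (fun q => (q.1, q.2.2)) (mh2 t)).
    by apply: measurable_fun_pair => //; exact: (measurableT_comp measurable_snd).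
  by apply/funext => q; rewrite /h dot_subl mulrBr.
have bkp p : bmeas (fun q : n.-tuple R * n.-tuple R => cos (h t (subv q.1 q.2) p)) := bmeas_pair1 p bk.
have ECS : \int[W]_p (Cp t p ^+ 2 + Sp t p ^+ 2) =
  \int[Q]_x \int[Q]_y expR (- (t ^+ 2 * dot (subv x y) (subv x y) / (2 * n%:R))).
  transitivity (\int[W]_p \int[prodP Q Q]_q cos (h t (subv q.1 q.2) p)).
    apply: eq_Rintegral => p _; rewrite [RHS](Rintegral_prod _ _ (bkp p)) /=.
    have ic : Q.-integrable setT (EFin \o (fun x => cos (h t x p))) := bmeas_integrable Q (bmeas_pair1 p bcos).
    have is_ : Q.-integrable setT (EFin \o (fun x => sin (h t x p))) := bmeas_integrable Q (bmeas_pair1 p bsin).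
    transitivity (\int[Q]_x (cos (h t x p) * Cp t p + sin (h t x p) * Sp t p)).
      rewrite RintegralD//; first by rewrite !RintegralZr// !expr2.
        by under eq_fun do rewrite mulrC; exact: intRZl.
      by under eq_fun do rewrite mulrC; exact: intRZl.
    apply: eq_Rintegral => x _; rewrite -!RintegralZl// -RintegralD//; [|exact: intRZl|exact: intRZl].
    by apply: eq_Rintegral => y _; rewrite -cosB /h dot_subl mulrBr.
  rewrite (RFubini _ _ bk).
  have bW : bmeas (fun q => \int[W]_p cos (h t (subv q.1 q.2) p)) := bmeas_Rintegral2 W (prodP Q Q) bk.
  rewrite [LHS](Rintegral_prod Q Q bW).
  by apply: eq_Rintegral => x _; apply: eq_Rintegral => y _; exact: sphere_gauss_cos.
transitivity (\int[W]_p (Cp t p ^+ 2 + Sp t p ^+ 2 + (gch t ^+ 2 - 2 * gch t * Cp t p))).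
  by apply: eq_Rintegral => p _; ring.
have bCS : bmeas (fun p => Cp t p ^+ 2 + Sp t p ^+ 2).
  by under eq_fun do rewrite !expr2; apply: bmeasD; apply: bmeasM.
have bgC : bmeas (fun p => 2 * gch t * Cp t p) by apply: bmeasM => //; exact: bmeas_cst.
rewrite RintegralD//; [|exact: bmeas_integrable|]; last first.
  by apply/bmeas_integrable/bmeasB => //; exact: bmeas_cst.
rewrite RintegralB//; [|exact/bmeas_integrable/bmeas_cst|exact: bmeas_integrable].
rewrite Rintegral_cstT RintegralZl//; last exact: bmeas_integrable.
by rewrite EC ECS; ring.
Qed.

End SphereGauss.

(** * Estimates in terms of the distribution of one component *)

Section ScalarBounds.
Context {R : realType}.

(** From [exp t - 1 <= t exp t], used twice for [t >= 0] and combined with [1 + t <= exp t] for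
    [t < 0]. *)
Lemma expR_tangent2 (t : R) : expR t <= 1 + t + t ^+ 2 * expR `|t|.
Proof.
have h1 : expR t - 1 <= t * expR t.
  have := expR_ge1Dx (- t); rewrite expRN => h.
  have := ler_wpM2r (expR_ge0 t) h; rewrite mulVf ?gt_eqF ?expR_gt0//; nra.
have h2 := expR_ge1Dx t.
have [t0|t0] := leP 0 t.
  rewrite ger0_norm//; have := ler_wpM2l t0 h1; rewrite expr2; nra.
rewrite ltr0_norm//; have e1 : 1 <= expR (- t) by rewrite -expR0 ler_expR oppr_ge0 ltW.
have : t ^+ 2 <= t ^+ 2 * expR (- t) by rewrite ler_peMr ?sqr_ge0.
have := ler_wnM2l (ltW t0) h2; nra.
Qed.

(** Convexity in [s]: the chord over [[0, 1]], from the tangent inequalities at [s] evaluated at [0]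
    and [1] with weights [1 - s] and [s]. *)
Lemma expRN_chord (s D : R) : 0 <= s <= 1 -> 0 <= D ->
  expR (- (s * D)) <= 1 - s * (1 - expR (- D)).
Proof.
move=> /andP[s0 s1] D0; have e0 := expR_ge0 (- (s * D)).
have h1 : expR (- (s * D)) * (1 - (1 - s) * D) <= expR (- D).
  have -> : - D = - (s * D) + - ((1 - s) * D) by ring.
  by rewrite expRD ler_wpM2l// expR_ge1Dx.
have h2 : expR (- (s * D)) * (1 + s * D) <= 1.
  have := expR_ge1Dx (s * D) => h; have := ler_wpM2l e0 h.
  by rewrite -expRD addNr expR0.
have := ler_wpM2l s0 h1; have := ler_wpM2l (_ : 0 <= 1 - s) h2; rewrite subr_ge0 => /(_ s1).
nra.
Qed.

(** [1 - exp (- u) <= min (1, u) <= sqrt u] at [u = s x^2]. The square root keeps the total power of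
    [x] at [2], the highest moment at hand. *)
Lemma le_norm_expRN (s x : R) : 0 <= s ->
  `|x * (expR (- (s * x ^+ 2)) - 1)| <= Num.sqrt s * x ^+ 2.
Proof.
move=> s0; set r := Num.sqrt s; have r0 : 0 <= r by exact: sqrtr_ge0.
have rs : s = r * r by rewrite -expr2 sqr_sqrtr.
rewrite normrM -[x ^+ 2]real_normK ?num_real//; set y := `|x|; have y0 : 0 <= y by exact: normr_ge0.
have u0 : 0 <= s * y ^+ 2 by rewrite mulr_ge0// sqr_ge0.
have e1 : expR (- (s * y ^+ 2)) <= 1 by rewrite -expR0 ler_expR oppr_le0.
have e0 := expR_ge0 (- (s * y ^+ 2)).
rewrite distrC ger0_norm ?subr_ge0//.
suff h : 1 - expR (- (s * y ^+ 2)) <= r * y.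
  by have := ler_wpM2l y0 h; move: (expR _) => e hh; rewrite expr2; nra.
have [ry|ry] := leP 1 (r * y); first by rewrite (le_trans _ ry)//; lra.
have h := expR_ge1Dx (- (s * y ^+ 2)).
have : s * y ^+ 2 <= r * y.
  by rewrite rs (_ : r * r * y ^+ 2 = (r * y) * (r * y)); [rewrite ler_piMr ?mulr_ge0// ltW|ring].
lra.
Qed.

Variable mu : probability R R.
Hypothesis mu1 : mu.-integrable setT (EFin \o (fun x : R => x)).
Hypothesis mean0 : \int[mu]_x x = 0.
Hypothesis mu2 : mu.-integrable setT (EFin \o (fun x : R => x ^+ 2)).

Definition m2 : R := \int[mu]_x (x ^+ 2).
Definition beta (s : R) : R := \int[mu]_x expR (- (s * x ^+ 2)).
Definition alph (s : R) : R := \int[mu]_x \int[mu]_y expR (- (s * (x - y) ^+ 2)).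

Lemma m2_ge0 : 0 <= m2. Proof. by apply: Rintegral_ge0 => x _; exact: sqr_ge0. Qed.

Lemma bmeas_beta s : 0 <= s -> bmeas (fun x : R => expR (- (s * x ^+ 2))).
Proof.
move=> s0; apply: bmeas_expN; last by move=> x; rewrite mulr_ge0// sqr_ge0.
by apply: measurable_funM => //; exact: measurable_funX.
Qed.

Lemma bmeas_alph s : 0 <= s ->
  bmeas (fun z : R * R => expR (- (s * (z.1 - z.2) ^+ 2))).
Proof.
move=> s0; apply: bmeas_expN; last by move=> x; rewrite mulr_ge0// sqr_ge0.
by apply: measurable_funM => //; apply: measurable_funX; exact: measurable_funB.
Qed.

Let bmeas_alph2 s x : 0 <= s -> bmeas (fun y : R => expR (- (s * (x - y) ^+ 2))).
Proof. by move=> s0; exact: (bmeas_pair1 x (bmeas_alph s0)). Qed.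

Let bmeas_alph1 s : 0 <= s -> bmeas (fun x : R => \int[mu]_y expR (- (s * (x - y) ^+ 2))).
Proof. by move=> s0; exact: (bmeas_Rintegral1 mu mu (bmeas_alph s0)). Qed.

Lemma beta_ge0 s : 0 <= beta s. Proof. by apply: Rintegral_ge0 => x _; exact: expR_ge0. Qed.

Lemma alph_ge0 s : 0 <= alph s.
Proof. by apply: Rintegral_ge0 => x _; apply: Rintegral_ge0 => y _; exact: expR_ge0. Qed.

Lemma beta_le1 s : 0 <= s -> beta s <= 1.
Proof.
move=> s0; rewrite -[leRHS](Rintegral_cstT mu); apply: le_Rintegral => //.
- exact/bmeas_integrable/bmeas_beta.
- exact/bmeas_integrable/bmeas_cst.
- by move=> x _; rewrite -expR0 ler_expR oppr_le0 mulr_ge0// sqr_ge0.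
Qed.

Let gam (s : R) : R := \int[mu]_x (x * expR (- (s * x ^+ 2))).

Let igam s : 0 <= s -> mu.-integrable setT (EFin \o (fun x => x * expR (- (s * x ^+ 2)))).
Proof.
move=> s0; have [mb _] := bmeas_beta s0.
apply: (@le_intR _ _ _ mu _ (fun x => `|x|)).
- exact: measurable_funM.
- move=> x; rewrite normrM ler_piMr// ger0_norm ?expR_ge0//.
  by rewrite -expR0 ler_expR oppr_le0 mulr_ge0// sqr_ge0.
- exact: (@integrable_norm _ _ _ mu setT (fun x => x)).
Qed.

(** Mean zero allows [x] to be subtracted from the integrand, which [le_norm_expRN] then bounds by
    [sqrt s x^2]. *)
Let gam_le s : 0 <= s -> gam s ^+ 2 <= s * m2 ^+ 2.
Proof.
move=> s0; have -> : gam s = \int[mu]_x (x * (expR (- (s * x ^+ 2)) - 1)).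
  transitivity (\int[mu]_x (x * expR (- (s * x ^+ 2)) - x)).
    by rewrite RintegralB// ?mean0 ?subr0//; exact: igam.
  by apply: eq_Rintegral => x _; rewrite mulrBr mulr1.
have i1 : mu.-integrable setT (EFin \o (fun x => x * (expR (- (s * x ^+ 2)) - 1))).
  rewrite (_ : (fun x => _) = fun x => x * expR (- (s * x ^+ 2)) - x).
    by apply: intRB => //; exact: igam.
  by apply/funext => x; rewrite mulrBr mulr1.
set I := Rintegral _ _ _; have : `|I| <= Num.sqrt s * m2.
  rewrite (le_trans (le_normr_Rintegral _ i1))// -RintegralZl//.
  apply: le_Rintegral => //.
  - exact: (@integrable_norm _ _ _ mu setT (fun x => x * (expR (- (s * x ^+ 2)) - 1))).
  - exact: intRZl.
  - by move=> x _; exact: le_norm_expRN.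
move=> IM; rewrite -real_normK ?num_real// -{1}(sqr_sqrtr s0) -exprMn.
by rewrite lerXn2r// ?nnegrE// mulr_ge0 ?sqrtr_ge0// m2_ge0.
Qed.

(** Expand [exp (2 s x y)] to second order in [exp (- s (x - y)^2)]. The constant term gives
    [beta s ^+ 2]; the linear one [2 s gam(s)^2 <= 2 s^2 m2^2]; the remainder at most [4 s^2 m2^2],
    as [exp (- s x^2 - s y^2 + |2 s x y|) <= 1]. Hence the [6]. *)
Lemma alph_beta s : 0 <= s -> alph s <= beta s ^+ 2 + 6 * s ^+ 2 * m2 ^+ 2.
Proof.
move=> s0; have bb := bmeas_beta s0.
have pt x y : expR (- (s * (x - y) ^+ 2)) <=
   expR (- (s * x ^+ 2)) * expR (- (s * y ^+ 2)) +
   (2 * s * x * expR (- (s * x ^+ 2)) * (y * expR (- (s * y ^+ 2))) +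
   4 * s ^+ 2 * x ^+ 2 * y ^+ 2).
  set ex := expR (- (s * x ^+ 2)); set ey := expR (- (s * y ^+ 2)).
  have ex0 : 0 <= ex by exact: expR_ge0.
  have ey0 : 0 <= ey by exact: expR_ge0.
  pose t := 2 * s * x * y.
  have -> : expR (- (s * (x - y) ^+ 2)) = ex * ey * expR t.
    by rewrite -!expRD; congr expR; rewrite /t; ring.
  have h := ler_wpM2l (mulr_ge0 ex0 ey0) (expR_tangent2 t).
  have h2 : ex * ey * expR `|t| <= 1.
    rewrite -!expRD -expR0 ler_expR /t.
    have : `|2 * s * x * y| <= s * x ^+ 2 + s * y ^+ 2.
      rewrite ler_norml; apply/andP; split.
        by have := mulr_ge0 s0 (sqr_ge0 (x + y)); nra.
      by have := mulr_ge0 s0 (sqr_ge0 (x - y)); nra.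
    lra.
  have h3 := ler_wpM2l (sqr_ge0 t) h2.
  apply: (le_trans h); rewrite !mulrDr mulr1 -addrA lerD2l lerD//.
    by rewrite /t le_eqVlt; apply/orP; left; apply/eqP; ring.
  rewrite mulr1 in h3; rewrite mulrCA; apply: (le_trans h3).
  by rewrite /t le_eqVlt; apply/orP; left; apply/eqP; ring.
have ib : mu.-integrable setT (EFin \o (fun x => expR (- (s * x ^+ 2)))) := bmeas_integrable mu bb.
have ig := igam s0.
have inner x : \int[mu]_y expR (- (s * (x - y) ^+ 2)) <=
   expR (- (s * x ^+ 2)) * beta s +
   (2 * s * gam s * (x * expR (- (s * x ^+ 2))) + 4 * s ^+ 2 * m2 * x ^+ 2).
  apply: (le_trans (le_Rintegral measurableT (bmeas_integrable mu (bmeas_alph2 x s0)) _ (fun y _ => pt x y))).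
    by apply: intRD; [exact: intRZl|apply: intRD; exact: intRZl].
  rewrite RintegralD//; [|exact: intRZl|by apply: intRD; exact: intRZl].
  rewrite RintegralD//; [|exact: intRZl|exact: intRZl].
  rewrite !RintegralZl// -/(beta s) -/(gam s) -/m2 le_eqVlt; apply/orP; left; apply/eqP; ring.
apply: (le_trans (le_Rintegral measurableT (bmeas_integrable mu (bmeas_alph1 s0)) _ (fun x _ => inner x))).
  apply: intRD; last by apply: intRD; exact: intRZl.
  by under eq_fun do rewrite mulrC; exact: intRZl.
rewrite RintegralD//; [|by under eq_fun do rewrite mulrC; exact: intRZl|by apply: intRD; exact: intRZl].
rewrite RintegralD//; [|exact: intRZl|exact: intRZl].
rewrite RintegralZr// !RintegralZl// -/(beta s) -/(gam s) -/m2.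
have := ler_wpM2l s0 (gam_le s0); rewrite !expr2; nra.
Qed.

Lemma beta_chord s : 0 <= s <= 1 -> beta s <= 1 - s * (1 - beta 1).
Proof.
move=> s01; have /andP[s0 s1] := s01.
have bb := bmeas_beta s0; have b1 := bmeas_beta ler01.
have b2 : bmeas (fun x : R => s * (1 - expR (- (1 * x ^+ 2)))).
  by apply: bmeasM; [exact: bmeas_cst|apply: bmeasB => //; exact: bmeas_cst].
have -> : 1 - s * (1 - beta 1) = \int[mu]_x (1 - s * (1 - expR (- (1 * x ^+ 2)))).
  rewrite RintegralB//; [|exact/bmeas_integrable/bmeas_cst|exact: bmeas_integrable].
  rewrite RintegralZl//; last by apply/bmeas_integrable/bmeasB => //; exact: bmeas_cst.
  rewrite RintegralB//; [|exact/bmeas_integrable/bmeas_cst|exact: bmeas_integrable].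
  by rewrite !Rintegral_cstT.
apply: le_Rintegral => //; [exact: bmeas_integrable| |].
  by apply/bmeas_integrable/bmeasB => //; exact: bmeas_cst.
by move=> x _; rewrite mul1r; apply: expRN_chord => //; exact: sqr_ge0.
Qed.

Lemma alph_homo s t : 0 <= s -> s <= t -> alph t <= alph s.
Proof.
move=> s0 st; have t0 := le_trans s0 st.
apply: le_Rintegral => //; try by apply: bmeas_integrable; exact: bmeas_alph1.
move=> x _; apply: le_Rintegral => //; try by apply: bmeas_integrable; exact: bmeas_alph2.
by move=> y _; rewrite ler_expR lerN2 ler_wpM2r// sqr_ge0.
Qed.

Lemma alph_chord s : 0 <= s <= 1 -> alph s <= 1 - s * (1 - alph 1).
Proof.
move=> s01; have /andP[s0 s1] := s01.
have b2 x : bmeas (fun y : R => s * (1 - expR (- (1 * (x - y) ^+ 2)))).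
  by apply: bmeasM; [exact: bmeas_cst|apply: bmeasB; [exact: bmeas_cst|exact: bmeas_alph2]].
have b1 := bmeas_alph1 ler01.
have step (F : R -> R) : bmeas F -> 1 - s * (1 - \int[mu]_x F x) = \int[mu]_x (1 - s * (1 - F x)).
  move=> bF; have bF1 : bmeas (fun x => 1 - F x) by apply: bmeasB => //; exact: bmeas_cst.
  rewrite RintegralB//; [|exact/bmeas_integrable/bmeas_cst|exact: intRZl (bmeas_integrable mu bF1)].
  rewrite RintegralZl//; last exact: bmeas_integrable.
  rewrite RintegralB//; [|exact/bmeas_integrable/bmeas_cst|exact: bmeas_integrable].
  by rewrite !Rintegral_cstT.
rewrite step//; apply: le_Rintegral => //.
- exact/bmeas_integrable/bmeas_alph1.
- by apply/bmeas_integrable/bmeasB; [exact: bmeas_cst|apply: bmeasM; [exact: bmeas_cst|apply: bmeasB => //; exact: bmeas_cst]].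
move=> x _; rewrite step; last exact: bmeas_alph2.
apply: le_Rintegral => //.
- exact/bmeas_integrable/bmeas_alph2.
- by apply/bmeas_integrable/bmeasB => //; exact: bmeas_cst.
- by move=> y _; rewrite mul1r; apply: expRN_chord => //; exact: sqr_ge0.
Qed.

(* [alph s] is [1 - s (1 - beta 1) + O (s ^ 2)], hence below [1] for small [s],
   and [alph] is nonincreasing. *)
Lemma alph_lt1 : beta 1 < 1 -> alph 1 < 1.
Proof.
(* Small enough for the error [6 s^2 m2^2] of [alph_beta] to stay below the gain [s (1 - beta 1)] of
   [beta_chord]; the [+ 1] keeps the denominator positive. *)
move=> b1; pose s := Num.min 1 ((1 - beta 1) / (12 * m2 ^+ 2 + 1)).
have d0 : 0 < 12 * m2 ^+ 2 + 1 by rewrite ltr_wpDl// mulr_ge0// sqr_ge0.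
have s0 : 0 < s by rewrite lt_min ltr01 divr_gt0// subr_gt0.
have s1 : s <= 1 by rewrite ge_min lexx.
have sb : s * (12 * m2 ^+ 2 + 1) <= 1 - beta 1.
  by rewrite -ler_pdivlMr// ge_min lexx orbT.
apply: (le_lt_trans (alph_homo (ltW s0) s1)).
apply: (le_lt_trans (alph_beta (ltW s0))).
have bs := @beta_chord s (_ : 0 <= s <= 1); rewrite (ltW s0) s1 in bs.
have bs1 := bs isT.
have bs2 : beta s ^+ 2 <= beta s by rewrite expr2 ler_piMr ?beta_ge0// beta_le1// ltW.
have m0 : 0 <= m2 ^+ 2 by exact: sqr_ge0.
have : 6 * s ^+ 2 * m2 ^+ 2 < s * (1 - beta 1).
  have : s * (s * (12 * m2 ^+ 2 + 1)) <= s * (1 - beta 1) by rewrite ler_wpM2l// ltW.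
  have : 0 < s * s by rewrite mulr_gt0.
  have : 0 <= s * s * m2 ^+ 2 by rewrite mulr_ge0// ?sqr_ge0// mulr_ge0// ltW.
  by rewrite !expr2; lra.
lra.
Qed.

(** The chord bound covers [s <= 1]; beyond, monotonicity retains the value at [1]. *)
Lemma alph_exp s : 0 <= s -> alph s <= expR (- ((1 - alph 1) * Num.min s 1)).
Proof.
move=> s0; have [s1|s1] := leP s 1.
  rewrite (le_trans (alph_chord _)) ?s0//.
  by rewrite (le_trans _ (expR_ge1Dx _))//; lra.
rewrite (le_trans (alph_homo ler01 (ltW s1)))// mulr1.
by rewrite (le_trans _ (expR_ge1Dx _))//; lra.
Qed.

Lemma subrXX_le (a b : R) n : 0 <= b -> b <= a -> a ^+ n.+1 - b ^+ n.+1 <= n.+1%:R * (a - b) * a ^+ n.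
Proof.
move=> b0 ba; rewrite subrXX -mulrA mulrCA ler_wpM2l ?subr_ge0//.
have -> : n.+1%:R * a ^+ n = \sum_(i < n.+1) a ^+ n.
  by rewrite sumr_const card_ord mulr_natl.
apply: ler_sum => i _; rewrite /= (_ : a ^+ n = a ^+ (n - i) * a ^+ i).
  rewrite ler_wpM2l ?exprn_ge0// ?(le_trans b0)//.
  by rewrite lerXn2r// nnegrE (le_trans b0).
by rewrite -exprD subnK// -ltnS.
Qed.

(** The difference of [n.+1]-st powers costs a factor [n.+1] and leaves an [n]-th power of [alph s],
    bounded by [alph_exp]; the factor [s^2] comes from [alph_beta]. *)
Lemma variance_bound n s : 0 <= s ->
  alph s ^+ n.+1 - beta s ^+ n.+1 ^+ 2 <=
  6 * m2 ^+ 2 * (n.+1%:R * s ^+ 2 * expR (- ((1 - alph 1) * Num.min s 1)) ^+ n).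
Proof.
move=> s0; rewrite -exprM mulnC exprM.
have e0 := expR_ge0 (- ((1 - alph 1) * Num.min s 1)).
have r0 : 0 <= 6 * m2 ^+ 2 * (n.+1%:R * s ^+ 2 * expR (- ((1 - alph 1) * Num.min s 1)) ^+ n).
  apply: mulr_ge0; first by rewrite mulr_ge0// sqr_ge0.
  by apply: mulr_ge0; [rewrite mulr_ge0// sqr_ge0|exact: exprn_ge0].
have [ab|ab] := leP (alph s) (beta s ^+ 2).
  rewrite (le_trans _ r0)// subr_le0 lerXn2r// nnegrE ?alph_ge0//.
  by rewrite sqr_ge0.
rewrite (le_trans (subrXX_le _ (sqr_ge0 _) (ltW ab)))//.
have h1 : alph s - beta s ^+ 2 <= 6 * s ^+ 2 * m2 ^+ 2 by have := alph_beta s0; lra.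
have h2 : alph s ^+ n <= expR (- ((1 - alph 1) * Num.min s 1)) ^+ n.
  by rewrite lerXn2r// ?nnegrE ?alph_ge0// alph_exp.
rewrite (@le_trans _ _ (n.+1%:R * (6 * s ^+ 2 * m2 ^+ 2) * expR (- ((1 - alph 1) * Num.min s 1)) ^+ n))//.
  apply: ler_pM => //.
  - by rewrite mulr_ge0// subr_ge0 ltW.
  - exact/exprn_ge0/alph_ge0.
  - by rewrite ler_wpM2l.
by rewrite le_eqVlt; apply/orP; left; apply/eqP; ring.
Qed.

End ScalarBounds.

(** * The limiting mixture *)

Section Law.
Context {R : realType} {d} {T : measurableType d} (P : probability T R).
Variable f : T -> R.
Hypothesis mf : measurable_fun setT f.

Definition law : probability R R := distribution P (mfun_Sub (mem_set mf)).

Lemma Rintegral_law (g : R -> R) : bmeas g -> \int[law]_y g y = \int[P]_x g (f x).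
Proof.
move=> bg; congr fine; rewrite integral_distribution//.
  by apply/measurable_EFinP; case: bg.
by apply: (bmeas_integrable P (f := fun x => g (f x))); exact: (@bmeas_comp _ _ R _ T f).
Qed.

Lemma law_cdf x : lcdf law x = \int[P]_w ((f w <= x)%R)%:R.
Proof. by rewrite /lcdf Rintegral_law//; exact: bmeas_le. Qed.

Lemma law_cos t : lcos law t = \int[P]_w cos (t * f w).
Proof. by rewrite /lcos Rintegral_law//; apply: bmeas_cos; exact: measurable_funM. Qed.

Lemma law_sin t : lsin law t = \int[P]_w sin (t * f w).
Proof. by rewrite /lsin Rintegral_law//; apply: bmeas_sin; exact: measurable_funM. Qed.

Lemma law_integrable : P.-integrable setT (EFin \o f) -> law.-integrable setT (fun y => y%:E).
Proof.
move=> /integrableP[_ fi]; apply/integrableP; split; first exact/measurable_EFinP.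
rewrite [X in (X < _)%E](_ : _ = \int[P]_x `|(f x)%:E|)%E//.
apply: (@ge0_integral_distribution _ _ _ _ _ P (mfun_Sub (mem_set mf)) (fun y => `|y%:E|%E)).
  by apply: measurableT_comp => //; exact/measurable_EFinP.
by move=> y; exact: abse_ge0.
Qed.

End Law.

Section GaussMixture.
Context {R : realType}.
Variable mu : probability R R.

Lemma pw_beta (s : R) n : 0 <= s ->
  \int[pw mu n]_x expR (- (s * dot x x)) = beta mu s ^+ n.
Proof.
move=> s0; have bk : bmeas (fun z : R * R => expR (- (s * z.1 ^+ 2))).
  exact: (@bmeas_comp _ _ R _ (R * R)%type fst _ measurable_fst (bmeas_beta s0)).
have := pw_prod mu n bk => /=; under [X in _ = X ^+ n -> _]eq_Rintegral do rewrite Rintegral_cstT.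
rewrite -/(beta mu s) => <-; apply: eq_Rintegral => v _; rewrite Rintegral_cstT.
rewrite -expR_sum; congr expR; rewrite /dot mulr_sumr -sumrN; apply: eq_bigr => i _.
by rewrite expr2.
Qed.

Lemma pw_alph (s : R) n : 0 <= s ->
  \int[pw mu n]_x \int[pw mu n]_y expR (- (s * dot (subv x y) (subv x y))) =
  alph mu s ^+ n.
Proof.
move=> s0; rewrite -(pw_prod mu n (bmeas_alph s0)).
apply: eq_Rintegral => v _; apply: eq_Rintegral => w _.
rewrite -expR_sum; congr expR; rewrite /dot mulr_sumr -sumrN; apply: eq_bigr => i _.
by rewrite tnth_mktuple expr2.
Qed.

Hypothesis mu2 : mu.-integrable setT (EFin \o (fun x : R => x ^+ 2)).

Lemma pw_integrable_dot n : (pw mu n).-integrable setT (EFin \o (fun v => dot v v)).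
Proof.
elim: n => [|n IH].
  rewrite (_ : (fun v => _) = fun=> 0); first exact/bmeas_integrable/bmeas_cst.
  by apply/funext => v; rewrite /dot big_ord0.
apply: integrable_pwS; first exact: measurable_dot.
rewrite (_ : integral _ _ _ = (\int[mu]_x (x ^+ 2 + \int[pw mu n]_u dot u u)%:E)%E).
  by apply: integrable_lty => //; apply: intRD => //; exact/bmeas_integrable/bmeas_cst.
apply: eq_integral => x _.
rewrite -[X in _ = (X + _)%:E](Rintegral_cstT (pw mu n)) -RintegralD//; last first.
  exact/bmeas_integrable/bmeas_cst.
rewrite -EFin_Rintegral; last by apply: intRD => //; exact/bmeas_integrable/bmeas_cst.
by apply: eq_integral => u _; rewrite ger0_norm ?dot_ge0// dot_consT -expr2.
Qed.

Variable n : nat.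
Hypothesis n0 : (0 < n)%N.
Local Notation Q := (pw mu n).

Lemma measurable_dotr (th : n.-tuple R) : measurable_fun setT (fun v : n.-tuple R => dot v th).
Proof. exact: measurable_dot. Qed.

(** Defined for every vector [th], since it is also taken at the multiples [lam z] of points of the
    sphere. *)
Definition nuF (th : n.-tuple R) : probability R R := law Q (measurable_dotr th).

Lemma nuF_integrable th : (nuF th).-integrable setT (fun y => y%:E).
Proof.
apply: law_integrable.
apply: (@le_intR _ _ _ Q _ (fun v => dot v v + dot th th)).
- exact: measurable_dot.
- move=> v; rewrite /dot -big_split/= (le_trans (ler_norm_sum _ _ _))//.
  apply: ler_sum => i _; rewrite normrM -!expr2 -[tnth v i ^+ 2]real_normK ?num_real//.
  rewrite -[tnth th i ^+ 2]real_normK ?num_real//.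
  have := sqr_ge0 (`|tnth v i| - `|tnth th i|).
  have := sqr_ge0 `|tnth v i|; have := sqr_ge0 `|tnth th i|; nra.
- by apply: intRD; [exact: pw_integrable_dot|exact/bmeas_integrable/bmeas_cst].
Qed.

Lemma measurable_rZ : measurable_fun setT (fun p : n.-tuple R * R => lam p.1 * p.2).
Proof.
apply: measurable_funM => //; apply: measurableT_comp; first exact: measurable_lam.
exact: measurable_fst.
Qed.

Definition nuG : probability R R := law (prodP Q gauss) measurable_rZ.

Lemma nuG_integrable : nuG.-integrable setT (fun y => y%:E).
Proof.
apply: law_integrable.
have il : Q.-integrable setT (EFin \o (fun v => 1 + lam v ^+ 2)).
  apply: intRD; first exact/bmeas_integrable/bmeas_cst.
  rewrite (_ : (fun v => _) = fun v => n%:R^-1 * dot v v); first exact/intRZl/pw_integrable_dot.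
  by apply/funext => v; rewrite lam_sqr mulrC.
suff : (Q \x gauss)%E.-integrable setT (EFin \o (fun p : n.-tuple R * R => lam p.1 * p.2)) by exact.
have mE : measurable_fun setT (EFin \o (fun p : n.-tuple R * R => lam p.1 * p.2)).
  by apply/measurable_EFinP; exact: measurable_rZ.
apply/(integrable12ltyP _ _ mE).
apply: le_lt_trans (integrable_lty measurableT il).
apply: ge0_le_integral => //.
- by move=> v _; exact: integral_ge0.
- apply: (@measurable_fun_fubini_tonelli_F _ _ _ _ _ gauss (fun p => `|(lam p.1 * p.2)%:E|)%E).
    by apply: measurableT_comp => //; exact/measurable_EFinP/measurable_rZ.
  by move=> z; exact: abse_ge0.
- exact: (measurable_int Q il).
move=> v _; rewrite [leLHS](_ : _ = \int[gauss]_z (lam v * `|z|)%:E)%E; last first.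
  by apply: eq_integral => z _; rewrite /= normrM ger0_norm ?lam_ge0.
have ig : gauss.-integrable setT (EFin \o (fun z : R => `|z|)) := @gauss_integrable_norm R.
rewrite EFin_Rintegral; last exact: intRZl.
rewrite lee_fin RintegralZl// (le_trans (ler_piMr (lam_ge0 v) (@gauss_norm_le1 R)))//.
by have := sqr_ge0 (lam v - 1); have := sqr_ge0 (lam v); nra.
Qed.

(** The distribution function of [r Z] given [X = v]: normal of standard deviation [lam v], or a
    unit mass at [0] when [lam v = 0]. *)
Definition kv (v : n.-tuple R) (x : R) : R := \int[gauss]_z ((lam v * z <= x)%R)%:R.

Lemma nuG_cdf x : lcdf nuG x = \int[Q]_v kv v x.
Proof. by rewrite law_cdf; apply: Rintegral_prod; apply: bmeas_le => //; exact: measurable_rZ. Qed.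

Lemma bmeas_kv x : bmeas (fun v => kv v x).
Proof.
apply: (@bmeas_Rintegral1 _ _ _ _ _ Q gauss (fun p => ((lam p.1 * p.2 <= x)%R)%:R)).
by apply: bmeas_le => //; exact: measurable_rZ.
Qed.

Lemma kv0 v x : lam v = 0 -> kv v x = ((0 <= x)%R)%:R.
Proof.
by move=> l0; rewrite /kv; under eq_Rintegral do rewrite l0 mul0r; exact: Rintegral_cstT.
Qed.

Lemma kvE v x : 0 < lam v -> kv v x = Phi (x / lam v).
Proof.
by move=> l0; apply: eq_Rintegral => z _; rewrite ler_pdivlMr// mulrC.
Qed.

Lemma nuG_cos (t : R) : lcos nuG t = gch Q t.
Proof.
rewrite law_cos; transitivity (\int[Q]_v \int[gauss]_z cos (t * (lam v * z))).
  apply: (Rintegral_prod Q gauss (f := fun p => cos (t * (lam p.1 * p.2)))).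
  by apply: bmeas_cos; apply: measurable_funM => //; exact: measurable_rZ.
apply: eq_Rintegral => v _.
transitivity (\int[gauss]_z cos (0 + (t * lam v) * z)).
  by apply: eq_Rintegral => z _; rewrite add0r mulrA.
rewrite gauss_cos cos0 mul1r exprMn lam_sqr; congr (expR (- _)); field.
by rewrite pnatr_eq0 -lt0n.
Qed.

Lemma nuG_sin (t : R) : lsin nuG t = 0.
Proof.
rewrite law_sin; transitivity (\int[Q]_v \int[gauss]_z sin (t * (lam v * z))).
  apply: (Rintegral_prod Q gauss (f := fun p => sin (t * (lam p.1 * p.2)))).
  by apply: bmeas_sin; apply: measurable_funM => //; exact: measurable_rZ.
rewrite -[RHS](Rintegral_cstT Q); apply: eq_Rintegral => v _.
(* The sine is a cosine with phase [- pi / 2], and the cosine of this phase is [0]. *)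
transitivity (\int[gauss]_z cos (- (pi / 2) + (t * lam v) * z)).
  by apply: eq_Rintegral => z _; rewrite mulrA addrC cosB cos_pihalf sin_pihalf mulr0 add0r mulr1.
by rewrite gauss_cos cosN cos_pihalf mul0r.
Qed.

Lemma nuG_scale (l x : R) : 0 < l -> `|lcdf nuG (l * x) - lcdf nuG x| <= 2 * `|l - 1|.
Proof.
move=> l0; rewrite !nuG_cdf -RintegralB//; try exact/bmeas_integrable/bmeas_kv.
apply: bmeas_Rintegral_norm; first by case: (bmeasB (bmeas_kv (l * x)) (bmeas_kv x)).
move=> v; have [v0|v0] := eqVneq (lam v) 0.
  by rewrite !kv0// pmulr_rge0// subrr normr0 mulr_ge0.
have vp : 0 < lam v by rewrite lt_def v0 lam_ge0.
by rewrite !kvE// -mulrA; exact: Phi_scale.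
Qed.

(** Where [lam v >= sqrt q] the conditional density is at most [1 / sqrt q]. Elsewhere the increment
    is at most [1 <= exp (n q - |v|^2)], whose mean over [v] is the last power. *)
Lemma nuG_modulus (q h x : R) : 0 < q -> 0 <= h ->
  lcdf nuG (x + h) - lcdf nuG x <= h / Num.sqrt q + (expR q * beta mu 1) ^+ n.
Proof.
move=> q0 h0; rewrite !nuG_cdf -RintegralB//; try exact/bmeas_integrable/bmeas_kv.
set r := Num.sqrt q; have r0 : 0 < r by rewrite sqrtr_gt0.
have nr0 : 0 < n%:R :> R by rewrite ltr0n.
have be : bmeas (fun v : n.-tuple R => expR (n%:R * q) * expR (- dot v v)).
  by apply: bmeasM; [exact: bmeas_cst|apply: bmeas_expN; [exact: measurable_dot|exact: dot_ge0]].
have pt v : kv v (x + h) - kv v x <= h / r + expR (n%:R * q) * expR (- dot v v).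
  have e0 : 0 <= expR (n%:R * q) * expR (- dot v v) by rewrite mulr_ge0 ?expR_ge0.
  have [lr|lr] := leP r (lam v).
    have vp := lt_le_trans r0 lr.
    rewrite !kvE// (@le_trans _ _ (h / r))//; last by rewrite lerDl.
    rewrite (le_trans (Phi_lip _))//; first by rewrite ler_pM2r ?invr_gt0// lerDl.
    by rewrite -mulrBl addrC addKr ler_wpM2l// lef_pV2.
  have k01 y : 0 <= kv v y <= 1.
    apply/andP; split; first by apply: Rintegral_ge0.
    rewrite (le_trans (ler_norm _))//; apply: bmeas_Rintegral_norm.
      by apply: (proj1 (bmeas_le _ _)) => //; exact: measurable_funM.
    by move=> z; case: (_ <= y); rewrite ?normr1 ?normr0.
  have /andP[a1 a2] := k01 (x + h); have /andP[a3 a4] := k01 x.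
  have : 1 <= expR (n%:R * q) * expR (- dot v v).
    rewrite -expRD -[leLHS]expR0 ler_expR subr_ge0.
    have -> : dot v v = n%:R * lam v ^+ 2.
      by rewrite lam_sqr mulrC divfK// gt_eqF.
    apply: ler_wpM2l; first exact: ltW.
    have -> : q = r ^+ 2 by rewrite sqr_sqrtr// ltW.
    by rewrite lerXn2r// ?nnegrE ?lam_ge0 ?ltW.
  have : 0 <= h / r by rewrite divr_ge0// ltW.
  lra.
apply: (le_trans (le_Rintegral measurableT _ _ (fun v _ => pt v))).
- by apply/bmeas_integrable/bmeasB; exact: bmeas_kv.
- by apply/bmeas_integrable/bmeasD => //; exact: bmeas_cst.
rewrite RintegralD//; [|exact/bmeas_integrable/bmeas_cst|exact: bmeas_integrable].
rewrite Rintegral_cstT lerD2l RintegralZl//; last first.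
  by apply: bmeas_integrable; apply: bmeas_expN; [exact: measurable_dot|exact: dot_ge0].
rewrite exprMn -expRM_natl le_eqVlt; apply/orP; left; apply/eqP; congr (_ * _).
by rewrite -(pw_beta n ler01); apply: eq_Rintegral => v _; rewrite mul1r.
Qed.

End GaussMixture.

(** * Assembly *)

(* No measurability of [f]: the integral of a nonnegative function is the
   supremum of the integrals of the simple functions below it. *)
Lemma le_lower_integral {R : realType} {d} {T : measurableType d}
    (m : {measure set T -> \bar R}) (D : set T) (f g : T -> \bar R) :
  (forall x, D x -> 0 <= f x)%E -> (forall x, D x -> f x <= g x)%E ->
  (\int[m]_(x in D) f x <= \int[m]_(x in D) g x)%E.
Proof.
move=> f0 fg; rewrite integral_mkcond [leRHS]integral_mkcond.
have f0' x : (0 <= (f \_ D) x)%E by apply: erestrict_ge0.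
have fg' x : ((f \_ D) x <= (g \_ D) x)%E by apply: lee_restrict.
rewrite !ge0_integralTE//; last by move=> x; exact: le_trans (f0' x) (fg' x).
apply: ereal_sup_le => _ [h/= hf <-]; exists h => // x.
exact: le_trans (hf x) (fg' x).
Qed.

Lemma leq_double_pred n : (1 < n)%N -> (n <= 2 * n.-1)%N.
Proof. by lia. Qed.

Section Assembly.
Context {R : realType}.
Variables (mu : probability R R) (n : nat).
Hypothesis mu1 : mu.-integrable setT (EFin \o (fun x : R => x)).
Hypothesis mean0 : \int[mu]_x x = 0.
Hypothesis mu2 : mu.-integrable setT (EFin \o (fun x : R => x ^+ 2)).
Hypothesis n0 : (0 < n)%N.
Variable sigma : probability (n.-tuple R) R.
Hypothesis sigmaU : uniform_on_sphere sigma.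
Local Notation Q := (pw mu n).
Local Notation rn := (Num.sqrt (n%:R : R)).

Let rn_gt0 : 0 < rn. Proof. by rewrite sqrtr_gt0 ltr0n. Qed.

(** The integrand of [smoothing] at scale [e = rn^-1], the frequency being left in the form
    [w / e]. *)
Definition Dw (w : R) (p : n.-tuple R * n.-tuple R) : R :=
  (`|Cp Q (w / rn^-1) p - gch Q (w / rn^-1)| + `|Sp Q (w / rn^-1) p|) / `|w|.

Lemma nuF_scale_cdf (th : n.-tuple R) (l x : R) : 0 < l ->
  lcdf (nuF mu (scalev l th)) (l * x) = lcdf (nuF mu th) x.
Proof.
move=> l0; rewrite /nuF !law_cdf; apply: eq_Rintegral => v _.
by rewrite dot_scaler ler_pM2l.
Qed.

Let Bd (p : n.-tuple R * n.-tuple R) : \bar R := (\int[gauss]_w (Dw w p)%:E)%E.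

Lemma Dw_ge0 w p : 0 <= Dw w p.
Proof. by rewrite divr_ge0// addr_ge0. Qed.

(** [smoothing] compares the laws of [<X, l th>] and [r Z] at [l x], where [l = lam z]; [nuG_scale]
    then returns from [l x] to [x]. For [l = 0] the term [2 |l - 1| = 2] suffices. *)
Lemma pointwise_bound (om : R) (th z : n.-tuple R) (x : R) : 0 <= om ->
  (forall y, lcdf (nuG mu n) (y + 4 * rn^-1) - lcdf (nuG mu n) y <= om) ->
  (`|lcdf (nuF mu th) x - lcdf (nuG mu n) x|%:E <=
   2%:E * Bd (th, z) + (2 * om + 2 * `|lam z - 1|)%:E)%E.
Proof.
move=> om0 Hom.
have B0 : (0 <= Bd (th, z))%E by apply: integral_ge0 => w _; rewrite lee_fin Dw_ge0.
have [l0|l0] := eqVneq (lam z) 0.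
  apply: (@le_trans _ _ (2 * om + 2 * `|lam z - 1|)%:E); last by rewrite leeDr// mule_ge0.
  rewrite lee_fin l0 sub0r normrN1 mulr1.
  have /andP[? ?] := lcdf01 (nuF mu th) x; have /andP[? ?] := lcdf01 (nuG mu n) x.
  by rewrite ler_norml; apply/andP; split; lra.
have lp : 0 < lam z by rewrite lt_def l0 lam_ge0.
case BE : (Bd (th, z)) B0 => [K| |]// K0; last first.
  by rewrite gt0_muley ?lte_fin// addye// leey.
rewrite -EFinM -EFinD lee_fin.
have sm : forall y, `|lcdf (nuF mu (scalev (lam z) th)) y - lcdf (nuG mu n) y| <= 2 * K + 2 * om.
  apply: (@smoothing _ _ _ rn^-1) => //.
  - exact: nuF_integrable.
  - exact: nuG_integrable.
  - by rewrite invr_gt0.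
  rewrite -BE le_eqVlt; apply/orP; left; apply/eqP; apply: eq_integral => w _.
  rewrite nuG_cos// nuG_sin// subr0 /Dw /nuF law_cos law_sin.
  congr EFin; congr (_ / _); congr (_ + _); congr (Num.norm _); [congr (_ - _)|];
    by apply: eq_Rintegral => v _; rewrite dot_scaler mulrA.
have := sm (lam z * x); rewrite nuF_scale_cdf//.
have := @nuG_scale _ mu n (lam z) x lp.
set a := lcdf (nuF mu th) x; set b := lcdf (nuG mu n) x; set b' := lcdf _ (_ * x).
move=> h1 h2; have -> : a - b = (a - b') + (b' - b) by ring.
rewrite (le_trans (ler_normD _ _))//; lra.
Qed.

Let W : probability (n.-tuple R * n.-tuple R)%type R := prodP sigma (pw gauss n).

Lemma bmeas_CpSp :
  bmeas (fun q : (n.-tuple R * n.-tuple R) * R => Cp Q (q.2 / rn^-1) q.1) /\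
  bmeas (fun q : (n.-tuple R * n.-tuple R) * R => Sp Q (q.2 / rn^-1) q.1).
Proof.
have mphase : measurable_fun setT (fun r : ((n.-tuple R * n.-tuple R) * R) * n.-tuple R =>
    r.1.2 / rn^-1 * lam r.1.1.2 * dot r.2 r.1.1.1).
  have m1 : measurable_fun setT (fun r : ((n.-tuple R * n.-tuple R) * R) * n.-tuple R => r.1).
    exact: measurable_fst.
  have m11 : measurable_fun setT (fun r : ((n.-tuple R * n.-tuple R) * R) * n.-tuple R => r.1.1).
    exact: (measurableT_comp measurable_fst m1).
  apply: measurable_funM; first apply: measurable_funM.
  - by apply: measurable_funM => //; exact: (measurableT_comp measurable_snd m1).
  - by apply: (measurableT_comp (@measurable_lam _ n)); exact: (measurableT_comp measurable_snd m11).
  - by apply: measurable_dot => //; exact: (measurableT_comp measurable_fst m11).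
split.
  exact: (bmeas_Rintegral1 (prodP W (@gauss R)) Q (bmeas_cos mphase)).
exact: (bmeas_Rintegral1 (prodP W (@gauss R)) Q (bmeas_sin mphase)).
Qed.

Lemma measurable_Dw :
  measurable_fun setT (fun q : (n.-tuple R * n.-tuple R) * R => Dw q.2 q.1).
Proof.
have [bC bS] := bmeas_CpSp.
have mg : measurable_fun setT (fun q : (n.-tuple R * n.-tuple R) * R => gch Q (q.2 / rn^-1)).
  have mgp : measurable_fun setT (fun r : R * n.-tuple R =>
     (r.1 / rn^-1) ^+ 2 * dot r.2 r.2 / (2 * n%:R)).
    apply: measurable_funM => //; apply: measurable_funM; last exact: measurable_dot.
    by apply: measurable_funX; apply: measurable_funM.
  have bg : bmeas (fun r : R * n.-tuple R => expR (- ((r.1 / rn^-1) ^+ 2 * dot r.2 r.2 / (2 * n%:R)))).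
    apply: bmeas_expN => // r.
    apply: divr_ge0; last exact: mulr_ge0.
    by apply: mulr_ge0; [exact: sqr_ge0|exact: dot_ge0].
  have [m _] := bmeas_Rintegral1 (@gauss R) Q bg.
  exact: (measurableT_comp m measurable_snd).
apply: measurable_funM; last first.
  by apply: measurable_funV; apply: measurableT_comp; [exact: normr_measurable|exact: measurable_snd].
case: bC bS => mC _ [mS _].
apply: measurable_funD; apply: measurableT_comp => //; exact: measurable_funB.
Qed.

Variables (c : R).
Hypothesis c0 : 0 < c.
Hypothesis cE : c = 1 - alph mu 1.

(** Half of the decay rate [c (n - 1)] of the variance, since the first absolute moment is of the
    order of its square root. *)
Let kap : R := c * n.-1%:R / 2.

(** At [t = sqrt n w] the parameter [s = t^2 / (2 n)] is [w^2 / 2]. The deviation is linear in [s],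
    so dividing by [|w|] leaves a factor [|w|]. The two exponentials correspond to [s <= 1] and
    [s > 1]. *)
Lemma freq_bound w : (\int[W]_p (Dw w p)%:E <=
  ((3 * m2 mu ^+ 2 + 1) * (rn / 2) *
   (`|w| * expR (- (kap * (w ^+ 2 / 2))) + expR (- kap) * `|w|))%:E)%E.
Proof.
have M0 : 0 <= 3 * m2 mu ^+ 2 + 1 by rewrite addr_ge0// mulr_ge0// sqr_ge0.
have r2 : 0 <= rn / 2 by rewrite divr_ge0// ltW.
set t := w / rn^-1.
have [bCw bSw] := bmeas_CpSp.
have bC : bmeas (fun p => Cp Q t p - gch Q t).
  by apply: bmeasB; [exact: (bmeas_pair2 w bCw)|exact: bmeas_cst].
have bS : bmeas (Sp Q t) := bmeas_pair2 w bSw.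
have bD : bmeas (fun p => Dw w p).
  by apply: bmeasM; [apply: bmeasD; exact: bmeas_norm|exact: bmeas_cst].
rewrite EFin_Rintegral; last exact: bmeas_integrable.
rewrite lee_fin.
have rhs0 : 0 <= (3 * m2 mu ^+ 2 + 1) * (rn / 2) *
   (`|w| * expR (- (kap * (w ^+ 2 / 2))) + expR (- kap) * `|w|).
  apply: mulr_ge0; first exact: mulr_ge0.
  by apply: addr_ge0; apply: mulr_ge0 => //; exact: expR_ge0.
have [w0|w0] := eqVneq w 0.
  rewrite [leLHS](_ : _ = 0)//.
  by rewrite -[RHS](Rintegral_cstT W); apply: eq_Rintegral => p _; rewrite /Dw w0 normr0 invr0 mulr0.
have wp : 0 < `|w| by rewrite normr_gt0.
pose s := w ^+ 2 / 2.
have s0 : 0 < s by rewrite divr_gt0// exprn_even_gt0.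
pose E2 := expR (- (kap * Num.min s 1)).
(* The order of the standard deviation, by [V] below. As weight of the AM-GM inequality it plays the
   role of Cauchy-Schwarz, with [6 m2^2 / 2 + 1] as resulting constant. *)
pose eta := rn * s * E2.
have eta0 : 0 < eta by apply: mulr_gt0; [exact: mulr_gt0|exact: expR_gt0].
have nr0 : n%:R != 0 :> R by rewrite pnatr_eq0 -lt0n.
have rn2 : rn ^+ 2 = n%:R by rewrite sqr_sqrtr// ler0n.
have tE D : t ^+ 2 * D / (2 * n%:R) = s * D.
  by rewrite /t /s invrK exprMn rn2; field.
have V : \int[W]_p ((Cp Q t p - gch Q t) ^+ 2 + Sp Q t p ^+ 2) <= 6 * m2 mu ^+ 2 * eta ^+ 2.
  rewrite sphere_variance//.
  have -> : gch Q t = beta mu s ^+ n.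
    by rewrite -(pw_beta mu n (ltW s0)); apply: eq_Rintegral => v _; rewrite tE.
  have -> : \int[Q]_x \int[Q]_y expR (- (t ^+ 2 * dot (subv x y) (subv x y) / (2 * n%:R))) =
     alph mu s ^+ n.
    rewrite -(pw_alph mu n (ltW s0)); apply: eq_Rintegral => x _; apply: eq_Rintegral => y _.
    by rewrite tE.
  have := variance_bound mu1 mean0 mu2 n.-1 (ltW s0).
  rewrite prednK// -cE => /le_trans; apply.
  rewrite le_eqVlt; apply/orP; left; apply/eqP; congr (_ * _).
  rewrite /eta !exprMn rn2; congr (_ * _).
  by rewrite /E2 -!expRM_natl; congr expR; rewrite /kap; field.
have bV : bmeas (fun p => (Cp Q t p - gch Q t) ^+ 2 + Sp Q t p ^+ 2).
  by under eq_fun do rewrite !expr2; apply: bmeasD; apply: bmeasM.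
have step : \int[W]_p Dw w p <= (3 * m2 mu ^+ 2 + 1) * eta / `|w|.
  apply: (@le_trans _ _ (\int[W]_p (`|w|^-1 * ((2 * eta)^-1 * ((Cp Q t p - gch Q t) ^+ 2 + Sp Q t p ^+ 2) + eta)))).
    apply: le_Rintegral => //; first exact: bmeas_integrable.
      by apply/bmeas_integrable/bmeasM; [exact: bmeas_cst|apply: bmeasD; [apply: bmeasM => //; exact: bmeas_cst|exact: bmeas_cst]].
    move=> p _; rewrite /Dw -/t mulrC ler_wpM2l ?invr_ge0//.
    (* AM-GM *)
    have am (a : R) : `|a| <= (2 * eta)^-1 * a ^+ 2 + eta / 2.
      have e2 : 0 < 2 * eta by exact: mulr_gt0.
      rewrite -(ler_pM2l e2) mulrDr [2 * eta * (_ * _)]mulrA mulfV ?gt_eqF// mul1r.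
      rewrite -[a ^+ 2]real_normK ?num_real//; have := sqr_ge0 (`|a| - eta).
      by move: `|a| => b; rewrite !expr2; lra.
    have := am (Cp Q t p - gch Q t); have := am (Sp Q t p); rewrite mulrDr; lra.
  rewrite RintegralZl//; last first.
    by apply/bmeas_integrable/bmeasD; [apply: bmeasM => //; exact: bmeas_cst|exact: bmeas_cst].
  rewrite RintegralD//; [|exact/intRZl/bmeas_integrable|exact/bmeas_integrable/bmeas_cst].
  rewrite RintegralZl//; last exact: bmeas_integrable.
  rewrite Rintegral_cstT [leLHS]mulrC; apply: ler_wpM2r; first by rewrite invr_ge0.
  rewrite [leRHS]mulrDl mul1r lerD2r.
  have e20 : 0 <= (2 * eta)^-1 by rewrite invr_ge0 mulr_ge0// ltW.
  apply: le_trans (ler_wpM2l e20 V) _.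
  by rewrite le_eqVlt; apply/orP; left; apply/eqP; field; rewrite gt_eqF.
apply: (le_trans step).
have -> : (3 * m2 mu ^+ 2 + 1) * eta / `|w| = (3 * m2 mu ^+ 2 + 1) * (rn / 2) * (`|w| * E2).
  by rewrite /eta /s -[w ^+ 2]real_normK ?num_real//; field; rewrite gt_eqF.
apply: ler_wpM2l; first exact: mulr_ge0.
rewrite [expR (- kap) * _]mulrC -mulrDr ler_wpM2l// /E2.
have [s1|s1] := leP s 1; first by rewrite lerDl expR_ge0.
by rewrite mulr1 lerDr expR_ge0.
Qed.

Lemma kap_gt0 : (1 < n)%N -> 0 < kap.
Proof.
move=> n1; rewrite divr_gt0// mulr_gt0// ltr0n.
by case: (n) n1 => [|[]].
Qed.

(** The frequency integral is at most [3 / kap]: [2 / kap] from [gauss_kernel], [1 / kap] from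
    [exp (- kap)]. As [n <= 2 (n - 1)], one has [kap >= c n / 4], and the prefactor [sqrt n] reduces
    [1 / n] to [1 / sqrt n]. *)
Lemma freq_integral : (1 < n)%N ->
  (\int[W]_p Bd p <= (6 * (3 * m2 mu ^+ 2 + 1) / c / rn)%:E)%E.
Proof.
move=> n1; have k0 := kap_gt0 n1.
have M0 : 0 <= 3 * m2 mu ^+ 2 + 1 by rewrite addr_ge0// mulr_ge0// sqr_ge0.
have mE : measurable_fun setT (fun q : (n.-tuple R * n.-tuple R) * R => (Dw q.2 q.1)%:E).
  by apply/measurable_EFinP; exact: measurable_Dw.
have D0 q : (0 <= (fun q : (n.-tuple R * n.-tuple R) * R => (Dw q.2 q.1)%:E) q)%E.
  by rewrite lee_fin Dw_ge0.
have := @fubini_tonelli _ _ _ _ _ W gauss _ mE D0; rewrite /= => ->.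
have kc : continuous (fun w : R => `|w| * expR (- (kap * (w ^+ 2 / 2)))).
  move=> w; apply: cvgM; first exact: norm_continuous.
  apply: continuous_comp; last exact: continuous_expR.
  apply: continuous_comp; last exact: opp_continuous.
  by apply: cvgM; [exact: cvg_cst|apply: cvgM; [exact: exprn_continuous|exact: cvg_cst]].
have i1 : gauss.-integrable setT (EFin \o (fun w : R => `|w| * expR (- (kap * (w ^+ 2 / 2))))).
  apply: (@le_intR _ _ _ gauss _ (fun w => `|w|)).
  - exact: continuous_measurable_fun.
  - move=> w; rewrite normrM normr_id ler_piMr// ger0_norm ?expR_ge0//.
    rewrite -[leRHS]expR0 ler_expR oppr_le0; apply: mulr_ge0; first exact: ltW.
    by rewrite divr_ge0// sqr_ge0.
  - exact: gauss_integrable_norm.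
have i2 : gauss.-integrable setT (EFin \o (fun w : R => `|w|)) := @gauss_integrable_norm R.
have i3 : gauss.-integrable setT (EFin \o (fun w => `|w| * expR (- (kap * (w ^+ 2 / 2))) + expR (- kap) * `|w|)).
  by apply: intRD => //; exact: intRZl.
apply: (@le_trans _ _ (\int[gauss]_w ((3 * m2 mu ^+ 2 + 1) * (rn / 2) *
   (`|w| * expR (- (kap * (w ^+ 2 / 2))) + expR (- kap) * `|w|))%:E)%E).
  apply: le_lower_integral => w _; last exact: freq_bound.
  by apply: integral_ge0 => p _; rewrite lee_fin Dw_ge0.
rewrite EFin_Rintegral; last exact: intRZl.
rewrite lee_fin RintegralZl// RintegralD//; last exact: intRZl.
rewrite RintegralZl//.
have ek : expR (- kap) <= kap^-1.
  rewrite expRN lef_pV2 ?posrE ?expR_gt0//; have := expR_ge1Dx kap; lra.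
have b1 : expR (- kap) * \int[gauss]_w `|w| <= kap^-1.
  by rewrite (le_trans _ ek)// ler_piMr ?expR_ge0// gauss_norm_le1.
have b2 := gauss_kernel k0.
have r2 : 0 <= rn / 2 by rewrite divr_ge0// ltW.
apply: (@le_trans _ _ ((3 * m2 mu ^+ 2 + 1) * (rn / 2) * (3 / kap))).
  apply: ler_wpM2l; first exact: mulr_ge0.
  lra.
have rn2 : rn * rn = n%:R by rewrite -expr2 sqr_sqrtr// ler0n.
have kn : c * n%:R / 4 <= kap.
  have nn : n%:R <= 2 * n.-1%:R :> R by rewrite -natrM ler_nat leq_double_pred.
  by have := ler_wpM2l (ltW c0) nn; rewrite /kap; lra.
have cn0 : 0 < c * n%:R / 4 by rewrite divr_gt0// mulr_gt0// ltr0n.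
apply: (@le_trans _ _ ((3 * m2 mu ^+ 2 + 1) * (rn / 2) * (3 / (c * n%:R / 4)))).
  apply: ler_wpM2l; first exact: mulr_ge0.
  by rewrite ler_wpM2l// lef_pV2.
have := rn_gt0; set r := rn in rn2 * => rp.
rewrite -rn2 le_eqVlt; apply/orP; left; apply/eqP; field.
by rewrite !gt_eqF.
Qed.

End Assembly.

(** * The mean distance over the sphere *)

Section SphereBound.
Context {R : realType}.
Variables (mu : probability R R) (n : nat).
Hypothesis mu1 : mu.-integrable setT (EFin \o (fun x : R => x)).
Hypothesis mean0 : \int[mu]_x x = 0.
Hypothesis mu2 : mu.-integrable setT (EFin \o (fun x : R => x ^+ 2)).
Hypothesis n1 : (1 < n)%N.
Variable sigma : probability (n.-tuple R) R.
Hypothesis sigmaU : uniform_on_sphere sigma.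
Local Notation rn := (Num.sqrt (n%:R : R)).

Let n0 : (0 < n)%N. Proof. exact: ltnW. Qed.
Let W : probability (n.-tuple R * n.-tuple R)%type R := prodP sigma (pw gauss n).
Let B (p : n.-tuple R * n.-tuple R) : \bar R := (\int[gauss]_w (Dw mu w p)%:E)%E.

Let B_ge0 p : (0 <= B p)%E.
Proof. by apply: integral_ge0 => w _; rewrite lee_fin Dw_ge0. Qed.

Let mB : measurable_fun setT B.
Proof.
apply: (@measurable_fun_fubini_tonelli_F _ _ _ _ _ gauss
  (fun q : (n.-tuple R * n.-tuple R) * R => (Dw mu q.2 q.1)%:E)) => [|q].
  by apply/measurable_EFinP; exact: measurable_Dw.
by rewrite lee_fin Dw_ge0.
Qed.

Let mB2 th : measurable_fun setT (fun z => B (th, z)).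
Proof.
apply: (@measurableT_comp _ _ _ _ (n.-tuple R * n.-tuple R)%type _ B _ (fun z => (th, z))) => //.
exact: measurable_fun_pair.
Qed.

Lemma sphere_bound (om c : R) : 0 <= om -> 0 < c -> c = 1 - alph mu 1 ->
  (forall y, lcdf (nuG mu n) (y + 4 * rn^-1) - lcdf (nuG mu n) y <= om) ->
  (\int[sigma]_(th in sphere R n) rho (lcdf (nuF mu th)) (lcdf (nuG mu n)) <=
   (2 * (6 * (3 * m2 mu ^+ 2 + 1) / c / rn) + 2 * om + 2 * ((1 + gvar) / rn))%:E)%E.
Proof.
move=> om0 c0 cE Hom.
have mlam : measurable_fun setT (fun z : n.-tuple R => (2 * om + 2 * `|lam z - 1|)%:E).
  apply/measurable_EFinP; apply: measurable_funD => //; apply: measurable_funM => //.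
  by apply: measurableT_comp => //; apply: measurable_funB => //; exact: measurable_lam.
have k0 (z : n.-tuple R) : (0 <= (2 * om + 2 * `|lam z - 1|)%:E)%E.
  by rewrite lee_fin addr_ge0// mulr_ge0.
have mIB : measurable_fun setT (fun th => \int[pw gauss n]_z B (th, z))%E.
  exact: (@measurable_fun_fubini_tonelli_F _ _ _ _ _ (pw gauss n) B).
have IB0 th : (0 <= \int[pw gauss n]_z B (th, z))%E by apply: integral_ge0.
pose K2 : R := 2 * om + 2 * ((1 + gvar) / rn).
have K20 : 0 <= K2.
  apply: addr_ge0; first exact: mulr_ge0.
  by apply: mulr_ge0 => //; apply: divr_ge0 => //; rewrite addr_ge0// gvar_ge0.
have rho_le th : (rho (lcdf (nuF mu th)) (lcdf (nuG mu n)) <=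
    2%:E * \int[pw gauss n]_z B (th, z) + K2%:E)%E.
  apply: (@le_trans _ _ (\int[pw gauss n]_z (2%:E * B (th, z) + (2 * om + 2 * `|lam z - 1|)%:E))%E).
    (* The distance at [x] is constant in [z], hence its own mean over [z]; the resulting bound is
       free of [x] and passes to the supremum. *)
    apply: ge_ereal_sup => _ [x _ <-].
    rewrite -[leLHS]mule1 -(@probability_setT _ _ _ (pw (@gauss R) n)) -integral_cst//.
    apply: le_lower_integral => z _; first by rewrite lee_fin.
    exact: (pointwise_bound mu2 n0 th z x om0 Hom).
  rewrite ge0_integralD//; last 2 first.
  - by move=> z _; rewrite mule_ge0.
  - exact: (measurable_funeM 2%:E (mB2 th)).
  rewrite (ge0_integralZl (pw gauss n) measurableT (mB2 th))//; apply: leeD2l.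
  have ml : measurable_fun setT (fun z : n.-tuple R => (`|lam z - 1|)%:E).
    apply/measurable_EFinP.
    by apply: measurableT_comp => //; apply: measurable_funB => //; exact: measurable_lam.
  have -> : (\int[pw gauss n]_z (2 * om + 2 * `|lam z - 1|)%:E =
     (2 * om)%:E + 2%:E * \int[pw gauss n]_z (`|lam z - 1|)%:E)%E.
    rewrite -ge0_integralZl// -[X in (X + _)%E]mule1.
    rewrite -(@probability_setT _ _ _ (pw (@gauss R) n)) -integral_cst// -ge0_integralD//.
    - by move=> z _; rewrite /= lee_fin mulr_ge0.
    - exact: measurable_funeM.
  rewrite /K2 [leRHS]EFinD; apply: leeD2l; rewrite [leRHS]EFinM.
  by apply: lee_wpmul2l => //; exact: lam_dist.
have rho_ge0 th : (0 <= rho (lcdf (nuF mu th)) (lcdf (nuG mu n)))%E.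
  by apply: le_ereal_sup_tmp; exists (`|lcdf (nuF mu th) 0 - lcdf (nuG mu n) 0|%:E)%E => //; exists 0.
have mg : measurable_fun setT (fun th => 2%:E * \int[pw gauss n]_z B (th, z) + K2%:E)%E.
  by apply: emeasurable_funD => //; exact: measurable_funeM.
apply: (@le_trans _ _ (\int[sigma]_(th in sphere R n) (2%:E * \int[pw gauss n]_z B (th, z) + K2%:E))%E).
  exact: le_lower_integral.
apply: (@le_trans _ _ (\int[sigma]_th (2%:E * \int[pw gauss n]_z B (th, z) + K2%:E))%E).
  apply: ge0_subset_integral => //; first exact: measurable_sphere.
  by move=> th _; rewrite adde_ge0// mule_ge0.
rewrite ge0_integralD//; last 2 first.
- by move=> th _; rewrite mule_ge0.
- exact: (measurable_funeM 2%:E mIB).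
have -> : (\int[sigma]__ K2%:E = K2%:E)%E.
  rewrite integral_cst// -[RHS]mule1; congr (_ * _)%E.
  exact: probability_setT.
have -> : (\int[sigma]_th (2%:E * \int[pw gauss n]_z B (th, z)) =
    2%:E * \int[sigma]_th \int[pw gauss n]_z B (th, z))%E.
  by apply: ge0_integralZl => // th _; exact: IB0.
rewrite -addrA [leRHS]EFinD; apply: leeD; last by [].
rewrite [leRHS]EFinM; apply: lee_wpmul2l => //.
rewrite -(@fubini_tonelli1 _ _ _ _ _ sigma (pw gauss n) B)//.
exact: (freq_integral mu1 mean0 mu2 n0 sigmaU c0 cE n1).
Qed.

(* Choosing the threshold [q] for [|v| ^ 2 / n] so that
   [expR q * beta 1 <= expR (- q)]. *)
Lemma modulus_exists : beta mu 1 < 1 ->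
  exists2 K : R, 0 <= K & forall m, (0 < m)%N -> forall y,
    lcdf (nuG mu m) (y + 4 * (Num.sqrt m%:R)^-1) - lcdf (nuG mu m) y <= K / Num.sqrt m%:R.
Proof.
(* The maximum with [1 / 2] ensures [b > 0], so that [ln b] inverts the exponential. *)
move=> b1; pose b := Num.max (beta mu 1) 2^-1.
have b0 : 0 < b by rewrite lt_max invr_gt0 ltr0n orbT.
have bl : b < 1 by rewrite gt_max b1/= invf_lt1// ltr1n.
pose q := - ln b / 2.
have q0 : 0 < q by rewrite divr_gt0// oppr_gt0 ln_lt0// b0.
have eqb : expR q * beta mu 1 <= expR (- q).
  apply: (@le_trans _ _ (expR q * b)).
    by rewrite ler_wpM2l ?expR_ge0// le_max lexx.
  have bE : b = expR (- q - q).
    by rewrite -[LHS]lnK// ; congr expR; rewrite /q; field.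
  by rewrite {1}bE -expRD; rewrite addrCA subrr addr0.
(* The first term is the density bound over a step [4 / sqrt m]; the second comes from
   [exp (- q m) <= 1 / (q sqrt m)]. *)
exists (4 / Num.sqrt q + q^-1); first by apply: addr_ge0; [rewrite divr_ge0// sqrtr_ge0|rewrite invr_ge0 ltW].
move=> m m0 y; have r0 : 0 < Num.sqrt (m%:R : R) by rewrite sqrtr_gt0 ltr0n.
have h0 : 0 <= 4 * (Num.sqrt (m%:R : R))^-1 by rewrite mulr_ge0// invr_ge0 ltW.
apply: (le_trans (nuG_modulus mu m0 y q0 h0)).
rewrite [leRHS]mulrDl; apply: lerD; first by rewrite mulrAC.
have bq0 : 0 <= expR q * beta mu 1 by rewrite mulr_ge0 ?expR_ge0// beta_ge0.
apply: (@le_trans _ _ (expR (- q) ^+ m)); first by rewrite lerXn2r// nnegrE expR_ge0.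
rewrite -expRM_natl mulrN expRN -invfM.
have rm : Num.sqrt (m%:R : R) <= m%:R.
  rewrite -[leRHS](ger0_norm (ler0n _ _)) -sqrtr_sqr ler_sqrt ?sqr_ge0//.
  by rewrite -natrX ler_nat -{1}(expn1 m) leq_pexp2l.
have qm0 : 0 < q * Num.sqrt (m%:R : R) by exact: mulr_gt0.
rewrite lef_pV2 ?posrE ?expR_gt0//.
apply: (@le_trans _ _ (m%:R * q)); first by rewrite mulrC ler_wpM2r// ltW.
by apply: le_trans (expR_ge1Dx _); rewrite lerDr.
Qed.

End SphereBound.

(** * Return to the random vector *)

Section Link.
Context {R : realType}.

Lemma Rintegral_bool {d} {T : measurableType d} (P : probability T R) (b : T -> bool) :
  measurable_fun setT b -> (\int[P]_x ((b x)%:R)%:E = P [set x | b x])%E.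
Proof.
move=> mb; have mB : measurable [set x | b x].
  rewrite (_ : [set x | b x] = setT `&` b @^-1` [set true]); first exact: mb.
  by rewrite setTI; apply/seteqP; split.
transitivity (\int[P]_x (\1_[set x | b x] x)%:E)%E; last by rewrite integral_indic// setIT.
apply: eq_integral => x _; rewrite indicE; case bx : (b x); first by rewrite mem_set.
by rewrite memNset//= bx.
Qed.

Variables (mu : probability R R) (d : measure_display) (T : measurableType d).
Variables (P : probability T R) (n : nat) (X : {RV P >-> n.-tuple R}).
Hypothesis iidX : iid_components P X mu.

Lemma Rintegral_iid (g : n.-tuple R -> R) : bmeas g ->
  \int[P]_w g (X w) = \int[pw mu n]_v g v.
Proof.
move=> bg; transitivity (\int[distribution P X]_v g v).
  congr fine; rewrite integral_distribution//.
    by apply/measurable_EFinP; case: bg.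
  apply: (bmeas_integrable P (f := fun w => g (X w))).
  by apply: (@bmeas_comp _ _ (n.-tuple R) _ T X).
congr fine; apply: eq_measure_integral => A mA _; exact: (iid_law iidX mA).
Qed.

Lemma Ftheta_nuF (th : n.-tuple R) : Ftheta P X th = lcdf (nuF mu th).
Proof.
apply/funext => x; rewrite /nuF law_cdf -Rintegral_iid; last exact: bmeas_le (measurable_dotr th) _.
rewrite /Ftheta /Rintegral Rintegral_bool//.
by apply: measurable_fun_ler => //; exact: (measurableT_comp (measurable_dotr th)).
Qed.

Lemma Gdf_nuG : Gdf P X = lcdf (nuG mu n).
Proof.
apply/funext => x; rewrite nuG_cdf -Rintegral_iid; last exact: bmeas_kv.
congr fine; rewrite /product_measure1; apply: eq_integral => w _ /=.
rewrite /kv -EFin_Rintegral; last first.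
  by apply/bmeas_integrable/bmeas_le => //; exact: measurable_funM.
rewrite (Rintegral_bool (@gauss R)); last first.
  by apply: measurable_fun_ler => //; exact: measurable_funM.
rewrite [RHS]/=; congr (normal_prob _ _ _).
apply/seteqP; split => z; first by move/xsectionP.
by move=> h; apply/xsectionP.
Qed.

End Link.

(** [1 - exp (- |v|^2)] is nonnegative with integral [0], so [v = 0] almost everywhere and both laws
    are the unit mass at [0]. This is the case left out by [alph_lt1]. *)
Lemma degenerate_cdf {R : realType} (mu : probability R R) n (th : n.-tuple R) :
  beta mu 1 = 1 -> lcdf (nuF mu th) = lcdf (nuG mu n).
Proof.
move=> b1; apply/funext => x; rewrite nuG_cdf /nuF law_cdf.
have be : bmeas (fun v : n.-tuple R => expR (- (1 * dot v v))).
  apply: bmeas_expN; first by apply: measurable_funM => //; exact: measurable_dot.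
  by move=> v; rewrite mul1r dot_ge0.
have b1e : bmeas (fun v : n.-tuple R => 1 - expR (- (1 * dot v v))).
  by apply: bmeasB => //; exact: bmeas_cst.
have z0 : \int[pw mu n]_v (1 - expR (- (1 * dot v v))) = 0.
  rewrite RintegralB//; [|exact/bmeas_integrable/bmeas_cst|exact: bmeas_integrable].
  by rewrite Rintegral_cstT pw_beta// b1 expr1n subrr.
have ae0 : ae_eq (pw mu n) setT (fun v => (1 - expR (- (1 * dot v v)))%:E) (cst 0%E).
  apply/ae_eq_integral_abs => //; first by apply/measurable_EFinP; case: b1e.
  under eq_integral.
    move=> v _; rewrite /= ger0_norm; last first.
      by rewrite subr_ge0 -[leRHS]expR0 ler_expR oppr_le0 mul1r dot_ge0.
    over.
  by rewrite EFin_Rintegral ?z0//; exact: bmeas_integrable.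
congr fine; apply: ae_eq_integral => //.
- by apply/measurable_EFinP; case: (bmeas_le (measurable_dotr th) (@measurable_cst _ _ _ _ setT x)).
- by apply/measurable_EFinP; case: (bmeas_kv mu n x).
apply: filterS ae0 => v /= + _ => /(_ I) -[/eqP].
rewrite subr_eq0 mul1r eq_sym => /eqP ev.
have : expR (- dot v v) = expR 0 by rewrite expR0.
move=> /expR_inj/eqP; rewrite oppr_eq0 => /eqP v0; congr EFin.
have lv : lam v = 0 by rewrite /lam /enorm v0 sqrtr0 mul0r.
rewrite kv0//; congr ((_ <= _)%R%:R).
rewrite /dot big1// => i _; suff -> : tnth v i = 0 by rewrite mul0r.
move/eqP: v0; rewrite psumr_eq0; last by move=> j _; rewrite -expr2 sqr_ge0.
by move=> /allP/(_ i (mem_index_enum _)); rewrite mulf_eq0 orbb => /eqP.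
Qed.

Theorem theorem1p3 (R : realType) (mu : probability R R)
    (mean0 : ('E_mu[fun x : R => x] = 0)%E)
    (moment2 : ('E_mu[fun x : R => (x ^+ 2)%R] < +oo)%E) :
  exists c : R,
    forall (n : nat) (sigma : probability (n.-tuple R) R)
      (d : measure_display) (T : measurableType d) (P : probability T R)
      (X : {RV P >-> n.-tuple R}),
      (2 <= n)%N ->
      uniform_on_sphere sigma ->
      iid_components P X mu ->
      (\int[sigma]_(theta in sphere R n) rho (Ftheta P X theta) (Gdf P X)
        <= (c * Num.sqrt (ln n%:R / n%:R))%:E)%E.
Proof.
have mu2 : mu.-integrable setT (EFin \o (fun x : R => x ^+ 2)).
  apply/integrableP; split; first by apply/measurable_EFinP; exact: measurable_funX.
  move: moment2; rewrite unlock; apply: le_lt_trans; rewrite le_eqVlt; apply/orP; left.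
  by apply/eqP; apply: eq_integral => x _; rewrite /= ger0_norm// sqr_ge0.
have mu1 : mu.-integrable setT (EFin \o (fun x : R => x)).
  apply: (@le_intR _ _ _ mu _ (fun x => 1 + x ^+ 2)) => //.
    move=> x; have := sqr_ge0 (`|x| - 1); rewrite sqrrB1 real_normK ?num_real// -mulr_natr.
    by have := sqr_ge0 x; lra.
  by apply: intRD => //; exact/bmeas_integrable/bmeas_cst.
have m0 : \int[mu]_x x = 0.
  by move: mean0; rewrite unlock => /(congr1 fine).
have [b1|b1] := eqVneq (beta mu 1) 1.
  exists 0 => n sigma d T P X n2 sU iidX; rewrite mul0r.
  rewrite (Gdf_nuG iidX) integral0_eq// => th _; rewrite (Ftheta_nuF iidX) (degenerate_cdf th b1).
  apply/eqP; rewrite eq_le; apply/andP; split.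
    by apply: ge_ereal_sup => _ [x _ <-]; rewrite subrr normr0.
  by apply: le_ereal_sup_tmp; exists (`|lcdf (nuG mu n) 0 - lcdf (nuG mu n) 0|%:E)%E => //; exists 0.
have b1' : beta mu 1 < 1 by rewrite lt_neqAle b1 beta_le1.
pose c := 1 - alph mu 1.
have c0 : 0 < c by rewrite subr_gt0; exact: alph_lt1.
have [K K0 HK] := modulus_exists b1'.
pose C := 12 * (3 * m2 mu ^+ 2 + 1) / c + 2 * K + 2 * (1 + gvar).
have C0 : 0 <= C.
  apply: addr_ge0; last by apply: mulr_ge0 => //; rewrite addr_ge0// gvar_ge0.
  apply: addr_ge0; last exact: mulr_ge0.
  apply: divr_ge0; last exact: ltW.
  by apply: mulr_ge0 => //; apply: addr_ge0 => //; apply: mulr_ge0 => //; exact: sqr_ge0.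
have ln2 : 0 < ln (2 : R) by rewrite ln_gt0// ltr1n.
have sln2 : 0 < Num.sqrt (ln (2 : R)) by rewrite sqrtr_gt0.
(* The bound obtained is [C / sqrt n]; for [n >= 2] the logarithm of [n] is at least [ln 2]. *)
exists (C / Num.sqrt (ln 2)) => n sigma d T P X n2 sU iidX.
have n0 : (0 < n)%N by exact: ltnW.
have rn0 : 0 < Num.sqrt (n%:R : R) by rewrite sqrtr_gt0 ltr0n.
rewrite (Gdf_nuG iidX).
under eq_integral do rewrite (Ftheta_nuF iidX).
have om0 : 0 <= K / Num.sqrt (n%:R : R) by rewrite divr_ge0// ltW.
apply: (le_trans (sphere_bound mu1 m0 mu2 n2 sU om0 c0 (erefl c) (HK n n0))).
rewrite lee_fin; apply: (@le_trans _ _ (C / Num.sqrt n%:R)).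
  rewrite /C le_eqVlt; apply/orP; left; apply/eqP; field.
  by rewrite !gt_eqF.
rewrite -mulrA; apply: ler_wpM2l => //.
rewrite ler_pdivlMl// sqrtrM; last by rewrite ln_ge0// ler1n.
rewrite -sqrtrV ?ler0n// ler_wpM2r ?sqrtr_ge0//.
rewrite ler_sqrt; last by rewrite ln_ge0// ler1n.
by rewrite ler_ln ?posrE ?ltr0n// ler_nat.
Qed.
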